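(* Let $u\in C^\infty(\mathbb{S}^1,\mathbb{S}^1)$ with $\deg u=d\ge1$. For any $s\in(0,1)$, with $p=\frac1s$, $$E_s(u)-E_s(z^d)=4\pi^2\sum_{n=1}^\infty\gamma_{p,n}\,D(u^n),$$ and the series on the right-hand side is absolutely convergent.
   Context: $\mathbb{S}^1$ is the unit circle in $\mathbb{C}$; $z^d$ denotes the map $z\mapsto z^d$ on $\mathbb{S}^1$ and $u^n$ the pointwise $n$-th power. For $p=\frac1s$, $$E_s(v)=\int_{\mathbb{S}^1}\int_{\mathbb{S}^1}\frac{|v(x)-v(y)|^p}{|x-y|^2}\,dx\,dy$$ with arclength measure and $|x-y|$ the distance in $\mathbb{C}$. For $v\colon\mathbb{S}^1\to\mathbb{S}^1$ smooth with Fourier series $v(e^{it})=\sum_{k\in\mathbb{Z}}a_ke^{ikt}$, the defect is $D(v)=\sum_{k<0}|k|\,|a_k|^2$. The coefficients are $$\gamma_{p,n}=\frac{-2(-1)^n\,\Gamma(p+1)}{\Gamma\left(1+\frac p2+n\right)\Gamma\left(1+\frac p2-n\right)},\qquad n\ge1,$$ interpreted as $0$ if $\Gamma\left(1+\frac p2-n\right)$ is at a pole. *)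

(* Defs.v *)
From HB Require Import structures.
From mathcomp Require Import all_boot all_order all_algebra.
From mathcomp Require Import all_classical all_reals all_analysis.
From mathcomp Require Import complex.

Set Implicit Arguments.
Unset Strict Implicit.
Unset Printing Implicit Defensive.

Import Order.TTheory GRing.Theory Num.Theory.
Import numFieldNormedType.Exports.

Local Open Scope classical_set_scope.
Local Open Scope ring_scope.
Local Open Scope complex_scope.

(* Maps of the unit circle are represented by functions R[i] -> R[i]; every
   notion below depends only on their values on the unit circle. *)

Definition cabs (R : realType) (z : R[i]) : R := ComplexField.Normc.normc z.

(* The point e^{it}. *)
Definition expi (R : realType) (t : R) : R[i] := cos t +i* sin t.

Definition circle_map (R : realType) (u : R[i] -> R[i]) : Prop :=
  forall z : R[i], cabs z = 1 -> cabs (u z) = 1.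

Definition smooth (R : realType) (f : R -> R) : Prop :=
  forall (n : nat) (t : R), derivable (derive1n n f) t 1.

(* Smoothness on the circle is tested in the global coordinate t |-> e^{it}. *)
Definition smooth_on_circle (R : realType) (u : R[i] -> R[i]) : Prop :=
  smooth (fun t : R => complex.Re (u (expi t))) /\
  smooth (fun t : R => complex.Im (u (expi t))).

(* The degree of a continuous circle map, through a continuous lift to R. *)
Definition has_degree (R : realType) (u : R[i] -> R[i]) (d : int) : Prop :=
  exists phi : R -> R,
    [/\ continuous phi,
        forall t : R, u (expi t) = expi (phi t) &
        forall t : R, phi (t + 2 * pi) = phi t + 2 * pi * d%:~R].

(* The integrals are Lebesgue integrals of nonnegative functions, valued in
   [0, +oo]; on the null set x = y the integrand takes the value 0. *)
Definition energy (R : realType) (s : R) (v : R[i] -> R[i]) : \bar R :=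
  (\int[lebesgue_measure]_(x in `[0%R, (2 * pi)%R])
   \int[lebesgue_measure]_(y in `[0%R, (2 * pi)%R])
     (cabs (v (expi x) - v (expi y)) `^ s^-1
        / cabs (expi x - expi y) ^+ 2)%:E)%E.

(* a_k = (1 / 2 pi) \int_0^{2 pi} v(e^{it}) e^{-ikt} dt, where real and
   imaginary parts are integrated separately. *)
Definition fourier_coef (R : realType) (v : R[i] -> R[i]) (k : int) : R[i] :=
  let g := fun t : R => v (expi t) * expi (- (k%:~R * t)) in
  ((2 * pi)^-1 * \int[lebesgue_measure]_(t in `[0, 2 * pi]) complex.Re (g t)) +i*
  ((2 * pi)^-1 * \int[lebesgue_measure]_(t in `[0, 2 * pi]) complex.Im (g t)).

(* The sum over k < 0, reindexed by j = - k >= 1. *)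
Definition defect (R : realType) (v : R[i] -> R[i]) : \bar R :=
  (\sum_(1 <= j <oo) (j%:R * cabs (fourier_coef v (- j%:Z)) ^+ 2)%:E)%E.

(* Euler's integral, meaningful for 0 < x. *)
Definition euler_gamma (R : realType) (x : R) : R :=
  \int[lebesgue_measure]_(t in `]0, +oo[) (t `^ (x - 1) * expR (- t)).

(* For x <= 0, Gamma is extended by the functional equation
   Gamma (x + n) = x (x + 1) ... (x + n - 1) Gamma x, with n > |x|. *)
Definition Gamma (R : realType) (x : R) : R :=
  if 0 < x then euler_gamma x
  else let n := Num.bound x in
       euler_gamma (x + n%:R) / \prod_(k < n) (x + k%:R).

Definition Gamma_pole (R : realType) (x : R) : bool :=
  (x \is a Num.int) && (x <= 0).

Definition gamma_coef (R : realType) (p : R) (n : nat) : R :=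
  if Gamma_pole (1 + p / 2 - n%:R) then 0
  else (- 2 * (-1) ^+ n * Gamma (p + 1))
       / (Gamma (1 + p / 2 + n%:R) * Gamma (1 + p / 2 - n%:R)).

(* Main.v *)
Require Import Defs.
From HB Require Import structures.
From mathcomp Require Import all_boot all_order all_algebra.
From mathcomp Require Import all_classical all_reals all_analysis.
From mathcomp Require Import complex.
From mathcomp Require Import measurable_realfun.
From mathcomp Require Import ring lra.

Set Implicit Arguments.
Unset Strict Implicit.
Unset Printing Implicit Defensive.

Import Order.TTheory GRing.Theory Num.Theory.
Import numFieldNormedType.Exports.

Local Open Scope classical_set_scope.
Local Open Scope ring_scope.
Local Open Scope complex_scope.

(** Put [q = p / 2] and [g n = gamma_coef p n], extended by [g 0]. The function
    [|e^{ih} - 1|^p = chord2 h ^ q] has the cosine expansion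
    [sum_n g n (1 - cos (n h))], with [sum_n n |g n| < oo] because [q > 1/2].
    Substituting [h = phi x - phi y], where [phi] lifts [u], and dividing by
    [chord2 (x - y)] gives [E_s(u) = sum_n g n A_n(phi)], where [A_n(phi)] is
    the double integral of [(1 - cos (n (phi x - phi y))) / chord2 (x - y)].
    Douglas' formula, obtained by Abel summation with the kernels
    [sum_j r^j sin (j h)] and their derivatives, reads
    [A_n(phi) = 4 pi^2 D(u^n) + 2 pi^2 n d]; for [phi t = d t] the defect
    vanishes, so the second term is [A_n] of [z^d] and cancels in the difference.

    The cosine expansion itself avoids Fourier inversion: by the recurrence
    for [g], the partial sums [S_N] satisfy [(1 - cos h) S_N' = q sin h S_N] up
    to a small error, so their limit is a constant multiple of
    [(1 - cos h) ^ q]. The constant is fixed by the mean of [chord2 ^ q] over the circle,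
    which is [Gamma (p + 1) / Gamma (q + 1) ^ 2]: the quotient of the two is
    1-periodic in [q] by the functional equations, and log-convexity of Gamma
    squeezes it to 1. *)

(** * The fundamental theorem of calculus on a segment *)

Section calculus.
Context {R : realType}.
Notation mu := (@lebesgue_measure R).

(** Finiteness of the energies is a result here, not an assumption, and the [g n] need not have one
    sign. Termwise integration is therefore Tonelli for the positive and negative parts, with the
    negative part moved to the other side of the equation. Both sides converge because [An] grows
    linearly in n, which matches the summability of n |g n| and asks for more than the pointwise
    bound n^2 on its integrand. The geometric obstacle is the diagonal, together with the two
    corners of the square that represent the same point of the circle: [chord2] vanishes there, and
    the limits r -> 1 are controlled by a factor 1 - cos that vanishes at least to the same order.
    The defect sums over negative frequencies only, so the Abel sums are one-sided. Their even part
    is a Poisson kernel, whose mass yields the degree term; their odd part yields the double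
    integral after an integration by parts. *)

Lemma integral_derive (F f : R -> R) (a b : R) : a < b ->
  {within `[a, b], continuous f} -> {within `[a, b], continuous F} ->
  (forall x, a < x < b -> is_derive x 1 F (f x)) ->
  (\int[mu]_(x in `[a, b]) (f x)%:E = (F b - F a)%:E)%E.
Proof.
move=> ab cf cF dF; rewrite (@continuous_FTC2 _ f F)//.
- have /(continuous_within_itvP _ ab)[_ Fa Fb] := cF; split => // x xab.
  by apply: ex_derive; apply: dF; rewrite in_itv/= in xab.
- move=> x; rewrite in_itv/= => xab; rewrite derive1E.
  by have [_ ->] := dF _ xab.
Qed.

Lemma Rintegral_derive (F f : R -> R) (a b : R) : a < b ->
  {within `[a, b], continuous f} -> {within `[a, b], continuous F} ->
  (forall x, a < x < b -> is_derive x 1 F (f x)) ->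
  \int[mu]_(x in `[a, b]) f x = F b - F a.
Proof. by move=> ab cf cF dF; rewrite /Rintegral (integral_derive ab cf cF dF). Qed.

Lemma derive_continuous_within (F f : R -> R) (a b : R) :
  (forall x, a <= x <= b -> is_derive x 1 F (f x)) ->
  {within `[a, b], continuous F}.
Proof.
move=> dF; apply: continuous_in_subspaceT => x; rewrite inE/= in_itv/= => xab.
by apply: differentiable_continuous; apply/derivable1_diffP; apply: ex_derive; exact: dF.
Qed.

End calculus.

(** * Euler's integral: functional equation and bounds on ratios *)

Section euler_integral.
Context {R : realType}.
Implicit Types (x y t q : R) (n m N : nat).
Notation mu := (@lebesgue_measure R).

Definition gamma_integrand x t : R := t `^ (x - 1) * expR (- t).

Definition egamma x : \bar R := (\int[mu]_(t in `]0%R, +oo[) (gamma_integrand x t)%:E)%E.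

Lemma euler_gammaE x : euler_gamma x = fine (egamma x).
Proof. by []. Qed.

Lemma gamma_integrand_ge0 x t : 0 <= gamma_integrand x t.
Proof. by rewrite mulr_ge0 ?powR_ge0 ?expR_ge0. Qed.

Lemma measurable_gamma_integrand x (D : set R) : measurable_fun D (gamma_integrand x).
Proof.
apply: measurable_funTS; apply: measurable_funM; first exact: measurable_powR.
by apply: measurableT_comp => //; exact: measurable_expR.
Qed.

Lemma measurable_egamma_integrand x (D : set R) :
  measurable_fun D (fun t => (gamma_integrand x t)%:E).
Proof. by apply/measurable_EFinP; exact: measurable_gamma_integrand. Qed.

Lemma gamma_integrandS x t : 0 < t -> gamma_integrand (x + 1) t = t * gamma_integrand x t.
Proof.
move=> t0; rewrite /gamma_integrand mulrA; congr (_ * _).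
rewrite addrAC [t `^ (_ + 1)]powRD; last by rewrite (gt_eqF t0) implybT.
by rewrite powRr1 ?ltW// mulrC.
Qed.

(** Exhausts the half-line from both ends at once, away from the singularity at 0; [I 0] is the
    single point 1. *)
Let I n : set R := `[(n.+1%:R)^-1, n.+1%:R].

Let bigcupI : \bigcup_n I n = `]0, +oo[%classic.
Proof.
apply/seteqP; split => [t [n _]|t]; rewrite /I /= !in_itv/= andbT.
  by move=> /andP[+ _]; apply: lt_le_trans; rewrite invr_gt0.
move=> t0; exists (Num.bound (Num.max t t^-1)) => //=; rewrite in_itv/=.
set m := Num.bound _.
have : Num.max t t^-1 < m%:R by exact: unstable.ltr_bound.
rewrite gt_max => /andP[tm tVm].
have mS : (m%:R : R) <= m.+1%:R by rewrite ler_nat.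
rewrite (le_trans (ltW tm))// andbT -[leRHS]invrK lef_pV2 ?posrE ?invr_gt0//.
by rewrite (le_trans (ltW tVm)).
Qed.

Lemma egamma_cvg x :
  (\int[mu]_(t in I n) (gamma_integrand x t)%:E)%E @[n --> \oo] --> egamma x.
Proof.
rewrite /egamma -bigcupI; apply: ge0_nondecreasing_set_cvg_integral.
- apply/nondecreasing_seqP => n; rewrite subsetEset => t; rewrite /I/= !in_itv/=.
  move=> /andP[nt tn]; rewrite (le_trans tn) ?ler_nat// andbT.
  by rewrite (le_trans _ nt)// lef_pV2 ?posrE// ler_nat.
- by move=> n; exact: measurable_itv.
- by move=> n; exact: measurable_egamma_integrand.
- by move=> n t _; rewrite lee_fin gamma_integrand_ge0.
Qed.

Let Igt0 n t : I n t -> 0 < t.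
Proof. by rewrite /I/= in_itv/= => /andP[+ _]; apply: lt_le_trans; rewrite invr_gt0. Qed.

Lemma powR_expRN_cvg0 x : (n.+1%:R : R) `^ x * expR (- n.+1%:R) @[n --> \oo] --> 0.
Proof.
have [m xm] : exists m, x <= m%:R.
  by exists (Num.bound x); rewrite ltW// unstable.ltr_bound.
apply: (@squeeze_cvgr _ _ _ _ (cst 0) (fun n => (m.+1`!%:R : R) * harmonic n)); last 2 first.
- exact: cvg_cst.
- by rewrite -[X in _ --> X](mulr0 (m.+1`!%:R : R)); apply: cvgMr; exact: cvg_harmonic.
near=> n; rewrite mulr_ge0 ?powR_ge0 ?expR_ge0//= expRN.
have n1 : 1 <= n.+1%:R :> R by rewrite ler1n.
have n0 : 0 < n.+1%:R :> R by [].
rewrite ler_pdivrMr ?expR_gt0// (@le_trans _ _ (n.+1%:R ^+ m))//.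
  by rewrite -powR_mulrn// ler_powR.
have f0 : 0 < m.+1`!%:R :> R by rewrite ltr0n fact_gt0.
have := expR_ge1Dxn m (ltW n0).
set e := expR _ => he.
have {}he : n.+1%:R ^+ m.+1 <= m.+1`!%:R * e.
  rewrite mulrC -ler_pdivrMr//; apply: le_trans he; lra.
by rewrite mulrAC ler_pdivlMr// -exprSr.
Unshelve. all: by end_near. Qed.

Lemma powR_expRN_cvg0r x : 0 < x ->
  ((n.+1%:R)^-1 : R) `^ x * expR (- (n.+1%:R)^-1) @[n --> \oo] --> 0.
Proof.
move=> x0; rewrite -[X in _ --> X](mul0r (1 : R)); apply: cvgM; last first.
  rewrite -[X in _ --> X]expR0 -[X in expR X]oppr0.
  apply: continuous_cvg; first exact: continuous_expR.
  by apply: cvgN; exact: cvg_harmonic.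
apply: ((cvg_at_rightP _ _ _).1 (powR_cvg0 x0)).
by split => [n|]; [rewrite invr_gt0|exact: cvg_harmonic].
Qed.

(** Integration by parts on [I n]; the boundary terms [B n] tend to 0. The equation lives in the
    extended reals because [egamma_lty] deduces finiteness from it. *)
Lemma egammaS x : 0 < x -> egamma (x + 1) = (x%:E * egamma x)%E.
Proof.
move=> x0.
pose B n : R := ((n.+1%:R)^-1 : R) `^ x * expR (- (n.+1%:R)^-1) -
  (n.+1%:R : R) `^ x * expR (- n.+1%:R).
have E n : (\int[mu]_(t in I n) (gamma_integrand (x + 1) t)%:E +
            (n == 0%N)%:R%:E * 0 =
   x%:E * (\int[mu]_(t in I n) (gamma_integrand x t)%:E) + (B n)%:E)%E.
  rewrite mule0 adde0.
  (* [I 0] is a point, and the fundamental theorem asks for a nondegenerate segment. *)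
  case: n => [|n].
    by rewrite /I /B invr1 subrr set_itv1 !integral_set1 mule0 adde0.
  have ab : (n.+2%:R)^-1 < n.+2%:R :> R.
    by rewrite (@lt_le_trans _ _ 1) ?ler1n// invf_lt1 ?ltr1n.
  have cg y : {within I n.+1, continuous (gamma_integrand y)}.
    apply: (@derive_continuous_within _ _ (fun t =>
      t `^ (y - 1) * - expR (- t) + expR (- t) * ((y - 1) * t `^ (y - 1 - 1)))) => t tI.
    have t0 : 0 < t by apply: (@Igt0 n.+1); rewrite /I/= in_itv.
    have h := is_derive1_powR (y - 1) t0.
    by apply: is_derive_eq; rewrite /GRing.scale/= mulrN1.
  have dF t : (n.+2%:R)^-1 <= t <= n.+2%:R ->
      is_derive t 1 (fun t : R => - (t `^ x * expR (- t)))
        (gamma_integrand (x + 1) t - x * gamma_integrand x t).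
    move=> tI; have t0 : 0 < t by apply: (@Igt0 n.+1); rewrite /I/= in_itv.
    have h := is_derive1_powR x t0.
    apply: is_derive_eq; rewrite /GRing.scale/= /gamma_integrand addrK; ring.
  have ig y : mu.-integrable (I n.+1) (EFin \o gamma_integrand y).
    by apply: continuous_compact_integrable => //; exact: segment_compact.
  have cxg : {within I n.+1, continuous (fun t => x * gamma_integrand x t)}.
    by move=> t; apply: cvgM; [exact: cvg_cst|exact: cg].
  have dFo t (tI : (n.+2%:R)^-1 < t < n.+2%:R) := dF t (subset_itv_oo_cc tI).
  have := integral_derive ab _ (derive_continuous_within dF) dFo.
  have -> : B n.+1 = - (n.+2%:R `^ x * expR (- n.+2%:R)) -
      - (n.+2%:R^-1 `^ x * expR (- n.+2%:R^-1)) by rewrite opprK addrC.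
  move=> <-; last by move=> t; apply: cvgB; [exact: cg|exact: cxg].
  have ixg : mu.-integrable (I n.+1) (EFin \o (fun t => x * gamma_integrand x t)).
    by apply: continuous_compact_integrable => //; exact: segment_compact.
  rewrite integralB_EFin//.
  have -> : (\int[mu]_(t in I n.+1) (x * gamma_integrand x t)%:E =
     x%:E * \int[mu]_(t in I n.+1) (gamma_integrand x t)%:E)%E.
    by rewrite -(@integralZl _ _ _ mu (I n.+1) (measurable_itv _) _ (ig x)).
  rewrite [RHS]addeC subeK//.
  by rewrite fin_numM//; apply: (@integrable_fin_num _ _ _ mu (I n.+1)); [exact: measurable_itv|exact: ig].
have B0 : (B n)%:E @[n --> \oo] --> 0%E.
  apply: cvg_EFin; first by apply: nearW.
  rewrite /= -[X in _ --> X](subrr (0 : R)).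
  by apply: cvgB; [exact: powR_expRN_cvg0r|exact: powR_expRN_cvg0].
rewrite -(cvg_lim (@ereal_hausdorff R) (@egamma_cvg (x + 1))).
apply: cvg_lim; first exact: ereal_hausdorff.
rewrite -[X in _ --> X]adde0.
have -> : (fun n => \int[mu]_(t in I n) (gamma_integrand (x + 1) t)%:E)%E =
   (fun n => x%:E * (\int[mu]_(t in I n) (gamma_integrand x t)%:E) + (B n)%:E)%E.
  by apply/funext => n; rewrite -E mule0 adde0.
apply: cvgeD => //; first by rewrite fin_num_adde_defl.
by apply: cvgeZl => //; exact: egamma_cvg.
Qed.

Lemma egamma1 : egamma 1 = 1%E.
Proof.
rewrite /egamma integral_itv_obnd_cbnd; last exact: measurable_egamma_integrand.
rewrite (@eq_integral _ _ _ mu _ (fun t => (expR (- t))%:E)); last first.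
  by move=> t _; rewrite /gamma_integrand subrr powRr0 mul1r.
rewrite (@ge0_continuous_FTC2y _ _ (fun t => - expR (- t)) _ 0).
- by rewrite oppr0 expR0 EFinN oppeK add0e.
- by move=> t _; exact: expR_ge0.
- apply: continuous_subspaceT => t.
  by apply: (@continuous_comp _ _ _ -%R expR); [exact: opp_continuous|exact: continuous_expR].
- by rewrite -[X in _ --> X]oppr0; apply: cvgN; exact: cvgr_expR.
- by move=> t _; apply: ex_derive.
- apply: cvg_at_right_filter; apply: cvgN.
  by apply: (@continuous_comp _ _ _ -%R expR); [exact: opp_continuous|exact: continuous_expR].
- by move=> t _; rewrite derive1E derive_val /GRing.scale/=; ring.
Qed.

Lemma egamma_ge0 x : (0 <= egamma x)%E.
Proof. by apply: integral_ge0 => t _; rewrite lee_fin gamma_integrand_ge0. Qed.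

(** Passing to x + 1 removes the singularity at 0: then t^x is at most 1 + t^m for an integer m >=
    x, and the integral is compared with those at 1 and m + 1, finite by the functional equation. *)
Lemma egamma_lty x : 0 < x -> (egamma x < +oo)%E.
Proof.
move=> x0.
suff : (egamma (x + 1) < +oo)%E.
  rewrite egammaS//; have := egamma_ge0 x.
  by case: (egamma x) => [r| |]//=; rewrite ?ltry// gt0_muley// lte_fin.
have nat_lty n : (egamma n.+1%:R < +oo)%E.
  elim: n => [|n IH]; first by rewrite egamma1 ltry.
  rewrite -natr1 egammaS//; move: IH; have := egamma_ge0 n.+1%:R.
  by case: (egamma n.+1%:R) => //= r _ _; rewrite -EFinM ltry.
have [m xm] : exists m, x <= m%:R.
  by exists (Num.bound x); rewrite ltW// unstable.ltr_bound.
apply: (@le_lt_trans _ _ (egamma 1 + egamma m.+1%:R)%E); last first.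
  by rewrite lte_add_pinfty// egamma1 ltry.
rewrite /egamma -ge0_integralD//=; last 4 first.
- by move=> t _; rewrite lee_fin gamma_integrand_ge0.
- exact: measurable_egamma_integrand.
- by move=> t _; rewrite lee_fin gamma_integrand_ge0.
- exact: measurable_egamma_integrand.
apply: ge0_le_integral => //=.
- by move=> t _; rewrite lee_fin gamma_integrand_ge0.
- exact: measurable_egamma_integrand.
- by apply: emeasurable_funD; exact: measurable_egamma_integrand.
move=> t; rewrite in_itv/= andbT => t0; rewrite -EFinD lee_fin /gamma_integrand.
rewrite -mulrDl ler_wpM2r ?expR_ge0// addrK subrr powRr0 -natr1 addrK powR_mulrn ?(ltW t0)//.
have [t1|/ltW t1] := lerP t 1.
  rewrite (@le_trans _ _ 1) ?lerDl ?exprn_ge0 ?(ltW t0)//.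
  by rewrite -(powRr0 t) ger_powR ?t0 ?(ltW x0).
rewrite (@le_trans _ _ (t ^+ m)) ?lerDr//.
by rewrite -powR_mulrn ?(ltW t0)// ler_powR.
Qed.

Lemma egammaE x : 0 < x -> egamma x = (euler_gamma x)%:E.
Proof.
by move=> x0; rewrite euler_gammaE fineK// ge0_fin_numE ?egamma_ge0 ?egamma_lty.
Qed.

Lemma euler_gammaS x : 0 < x -> euler_gamma (x + 1) = x * euler_gamma x.
Proof.
move=> x0; have := egammaS x0.
rewrite !egammaE//; last by rewrite addr_gt0.
by rewrite -EFinM => -[].
Qed.

Lemma euler_gamma1 : euler_gamma 1 = 1 :> R.
Proof. by rewrite euler_gammaE egamma1. Qed.

Lemma euler_gamma_gt0 x : 0 < x -> 0 < euler_gamma x.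
Proof.
move=> x0; rewrite -lte_fin -egammaE//.
apply: (@lt_le_trans _ _ (\int[mu]_(t in `[1%R, 2%R]) (2^-1 * expR (- 2) : R)%:E)%E).
  rewrite integral_cst//= lebesgue_measure_itv/= lte_fin ltr1n -EFinB -EFinM lte_fin.
  by rewrite !mulr_gt0 ?expR_gt0// subr_gt0 ltr1n.
apply: (@le_trans _ _ (\int[mu]_(t in `[1%R, 2%R]) (gamma_integrand x t)%:E)%E).
  apply: ge0_le_integral => //=.
  - exact: measurable_egamma_integrand.
  move=> t; rewrite in_itv/= => /andP[t1 t2]; rewrite lee_fin.
  rewrite ler_pM ?expR_ge0 ?ler_expR ?lerN2//.
  have t0 : 0 < t by rewrite (lt_le_trans _ t1).
  rewrite (@le_trans _ _ (t `^ (-1)))//.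
    by rewrite powR_inv1 ?(ltW t0)// lef_pV2 ?posrE.
  by rewrite ler_powR//; lra.
apply: ge0_subset_integral => //=.
- exact: measurable_egamma_integrand.
- by move=> t _; rewrite lee_fin gamma_integrand_ge0.
- by move=> t /=; rewrite !in_itv/= andbT => /andP[t1 _]; rewrite (lt_le_trans _ t1).
Qed.

(** Weighted AM-GM for u and 1. The tangent of [ln] at the weighted mean m bounds [ln u] and [ln 1];
    averaged with weights x and 1 - x, the two linear terms cancel. *)
Lemma powR_le_tangent x u : 0 <= x <= 1 -> 0 < u -> u `^ x <= x * u + (1 - x).
Proof.
move=> /andP[x0 x1] u0; set m := _ + _.
have m0 : 0 < m.
  rewrite /m; have [->|xn0] := eqVneq x 0; first by rewrite mul0r add0r subr0.
  by rewrite ltr_wpDr ?subr_ge0// mulr_gt0// lt0r xn0.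
have ln_div_le v : 0 < v -> ln v - ln m <= v / m - 1.
  move=> v0; rewrite -ln_div ?posrE//.
  have {1}-> : v / m = 1 + (v / m - 1) by rewrite addrC subrK.
  by rewrite le_ln1Dx// ltrBrDl subrr divr_gt0.
have h1 := ln_div_le _ u0; have := ln_div_le _ (@ltr01 R); rewrite ln1 => h2.
rewrite /powR gt_eqF// -[leRHS]lnK ?posrE// ler_expR -subr_le0.
have -> : x * ln u - ln m = x * (ln u - ln m) + (1 - x) * (0 - ln m) by ring.
apply: (@le_trans _ _ (x * (u / m - 1) + (1 - x) * (1 / m - 1))).
  by rewrite lerD// ler_wpM2l// subr_ge0.
have -> : x * (u / m - 1) + (1 - x) * (1 / m - 1) = m / m - 1.
  by rewrite {3}/m; ring.
by rewrite divff ?gt_eqF// subrr.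
Qed.

Lemma egammaZ x c : 0 <= c ->
  (c%:E * egamma x = \int[mu]_(t in `]0%R, +oo[) (c * gamma_integrand x t)%:E)%E.
Proof.
move=> c0; rewrite /egamma -ge0_integralZl_EFin//.
- by move=> t _; rewrite lee_fin gamma_integrand_ge0.
- exact: measurable_egamma_integrand.
Qed.

(* Weighted AM-GM under the integral replaces the Hölder inequality. *)
Lemma euler_gamma_le_interp x y l : 0 <= x <= 1 -> 0 < y -> 0 < l ->
  euler_gamma (y + x) <= l `^ x * (x / l * euler_gamma (y + 1) +
    (1 - x) * euler_gamma y).
Proof.
move=> x01 y0 l0; have /andP[x0 x1] := x01.
have lx0 : 0 <= l `^ x by exact: powR_ge0.
have xl0 : 0 <= l `^ x * x / l by rewrite divr_ge0 ?mulr_ge0// ltW.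
have lx1 : 0 <= l `^ x * (1 - x) by rewrite mulr_ge0// subr_ge0.
have yx0 : 0 < y + x by rewrite ltr_pwDl.
rewrite mulrDr !mulrA -lee_fin EFinD !(EFinM _ (euler_gamma _)) -!egammaE ?yx0 ?addr_gt0//.
rewrite !egammaZ// -ge0_integralD//=; last 4 first.
- by move=> t _; rewrite lee_fin; exact: mulr_ge0 xl0 (gamma_integrand_ge0 _ _).
- by apply/measurable_EFinP; apply: measurable_funM => //; exact: measurable_gamma_integrand.
- by move=> t _; rewrite lee_fin; exact: mulr_ge0 lx1 (gamma_integrand_ge0 _ _).
- by apply/measurable_EFinP; apply: measurable_funM => //; exact: measurable_gamma_integrand.
apply: ge0_le_integral => //=.
- by move=> t _; rewrite lee_fin gamma_integrand_ge0.
- exact: measurable_egamma_integrand.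
- by apply/measurable_EFinP; apply: measurable_funD; apply: measurable_funM => //;
    exact: measurable_gamma_integrand.
move=> t; rewrite in_itv/= andbT => t0; rewrite lee_fin.
rewrite gamma_integrandS// !mulrA -mulrDl /gamma_integrand addrAC [t `^ (_ + x)]powRD; last first.
  by rewrite (gt_eqF t0) implybT.
rewrite ler_wpM2r ?expR_ge0// mulrC -mulrDl ler_wpM2r ?powR_ge0//.
have -> : t `^ x = l `^ x * (t / l) `^ x.
  by rewrite -powRM ?divr_ge0 ?(ltW l0) ?(ltW t0)// [l * _]mulrC divfK ?gt_eqF.
have := ler_wpM2l lx0 (powR_le_tangent x01 (divr_gt0 t0 l0)).
by move=> /le_trans; apply; rewrite mulrDr lerD2r le_eqVlt; apply/orP; left; apply/eqP; ring.
Qed.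

(** The scale l = y, the quotient of the Gamma values at y + 1 and y, is where the interpolation
    bound is sharpest. *)
Lemma euler_gamma_ratio_le x y : 0 <= x <= 1 -> 0 < y ->
  euler_gamma (y + x) <= y `^ x * euler_gamma y.
Proof.
move=> x01 y0; apply: le_trans (euler_gamma_le_interp x01 y0 y0) _.
rewrite euler_gammaS//.
suff -> : x / y * (y * euler_gamma y) + (1 - x) * euler_gamma y = euler_gamma y by [].
by field; rewrite gt_eqF.
Qed.

(** The upper bound with base y + x and increment 1 - x ends at y + 1, where the functional equation
    returns to y. *)
Lemma euler_gamma_ratio_ge x y : 0 <= x <= 1 -> 0 < y ->
  y * (y + x) `^ (x - 1) * euler_gamma y <= euler_gamma (y + x).
Proof.
move=> /andP[x0 x1] y0; have yx0 : 0 < y + x by rewrite ltr_pwDl.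
have x01' : 0 <= 1 - x <= 1 by rewrite subr_ge0 x1/= lerBlDr lerDl.
have := euler_gamma_ratio_le x01' yx0; have -> : y + x + (1 - x) = y + 1 by ring.
rewrite euler_gammaS// => h.
rewrite mulrAC -ler_pdivlMr ?powR_gt0// -powRN opprB.
by rewrite [leRHS]mulrC.
Qed.

(* Locking keeps conversion from unfolding the integral. *)
Definition gam : R -> R := locked (@euler_gamma R).

Lemma gamE x : gam x = euler_gamma x.
Proof. by rewrite /gam -lock. Qed.

Lemma gamS x : 0 < x -> gam (x + 1) = x * gam x.
Proof. by rewrite !gamE; exact: euler_gammaS. Qed.

Lemma gam1 : gam 1 = 1.
Proof. by rewrite gamE euler_gamma1. Qed.

Lemma gam_gt0 x : 0 < x -> 0 < gam x.
Proof. by rewrite gamE; exact: euler_gamma_gt0. Qed.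

Lemma gam_ratio_le x y : 0 <= x <= 1 -> 0 < y -> gam (y + x) <= y `^ x * gam y.
Proof. by rewrite !gamE; exact: euler_gamma_ratio_le. Qed.

Lemma gam_ratio_ge x y : 0 <= x <= 1 -> 0 < y ->
  y * (y + x) `^ (x - 1) * gam y <= gam (y + x).
Proof. by rewrite !gamE; exact: euler_gamma_ratio_ge. Qed.

End euler_integral.

(** * The coefficients as finite products, and the growth of [central] *)

Section gamma_coefficients.
Context {R : realType}.
Implicit Types (x y t q : R) (n m N : nat).

Lemma gam_prod x n : 0 < x ->
  gam (x + n%:R) = gam x * \prod_(k < n) (x + k%:R).
Proof.
move=> x0; elim: n => [|n IH]; first by rewrite addr0 big_ord0 mulr1.
rewrite big_ord_recr/= mulrA -IH -natr1 addrA gamS; first by rewrite mulrC.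
by rewrite ltr_wpDr.
Qed.

(** Two admissible shifts N and M are compared through N + M: beyond a shift that reaches the
    positive axis, every further factor is positive and cancels by [gam_prod]. *)
Lemma Gamma_shift x n : 0 < x + n%:R ->
  Gamma x = gam (x + n%:R) / \prod_(k < n) (x + k%:R).
Proof.
have shift N j : 0 < x + N%:R -> gam (x + N%:R) / \prod_(k < N) (x + k%:R) =
    gam (x + (N + j)%:R) / \prod_(k < N + j) (x + k%:R).
  move=> xN; rewrite big_split_ord/= natrD addrA (gam_prod j xN).
  under [X in _ = _ / (_ * X)]eq_bigr do rewrite natrD addrA.
  rewrite invfM mulrACA [X in _ = _ * X]divff ?mulr1//; apply/prodf_neq0 => i _.
  by rewrite gt_eqF// ltr_wpDr.
have indep N M : 0 < x + N%:R -> 0 < x + M%:R ->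
    gam (x + N%:R) / \prod_(k < N) (x + k%:R) =
    gam (x + M%:R) / \prod_(k < M) (x + k%:R).
  by move=> xN xM; rewrite (shift N M)// (shift M N)// addnC.
move=> xn; rewrite /Gamma -!gamE; case: ifPn => [x0|].
  have := indep 0%N n; rewrite addr0 big_ord0 divr1; exact.
rewrite -leNgt => x0; apply: indep => //.
have := unstable.ltrNbound x; rewrite -subr_gt0 opprK addrC; exact.
Qed.

(** The central binomial coefficient, 2q over q, for real q. *)
Definition central q : R := gam (2 * q + 1) / gam (q + 1) ^+ 2.

(** The Gamma quotient of [gamma_coef] at p = 2q, unrolled into a product. A pole of the
    denominator, that is an integer q < n, shows up as the zero factor k = q. The form makes sense
    at n = 0 and gives the recurrence [gseqS] at once. *)
Definition gseq q n : R :=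
  locked (- 2 * (-1) ^+ n * central q * \prod_(k < n) ((q - k%:R) / (q + 1 + k%:R))).

Lemma gseqE q n : gseq q n =
  - 2 * (-1) ^+ n * central q * \prod_(k < n) ((q - k%:R) / (q + 1 + k%:R)).
Proof. by rewrite /gseq -lock. Qed.

Lemma gamma_coefE q n : 0 < q -> gamma_coef (2 * q) n = gseq q n.
Proof.
move=> q0; rewrite /gamma_coef gseqE.
have -> : 2 * q / 2 = q by field.
rewrite prodf_div.
have revE : \prod_(k < n) (1 + q - n%:R + k%:R) = \prod_(k < n) (q - k%:R).
  rewrite (reindex_inj rev_ord_inj)/=; apply: eq_bigr => i _.
  rewrite natrB ?ltn_ord// -natr1; ring.
case: ifPn => [/andP[/intrP[z zE] z0]|_].
  have z0' : (z <= 0) by rewrite -(ler_int R) -zE.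
  have [m mE] : exists m : nat, z = - m%:Z.
    by exists `|z|%N; rewrite lez0_abs// opprK.
  have qE : q = n%:R - 1 - m%:R.
    move: zE; rewrite mE intrN -pmulrn => zE.
    have -> : q = (1 + q - n%:R) + n%:R - 1 by ring.
    by rewrite zE; ring.
  have mn : (m.+1 < n)%N by rewrite -(ltr_nat R) -natr1; move: q0; rewrite qE; lra.
  have kn : (n - m.+1 < n)%N by rewrite ltn_subrL/= (leq_trans _ mn).
  suff -> : \prod_(k < n) (q - k%:R) = 0 by rewrite mul0r mulr0.
  apply/eqP; rewrite prodf_seq_eq0; apply/hasP; exists (Ordinal kn) => /=.
    by rewrite mem_index_enum.
  by rewrite natrB ?(ltnW mn)// -natr1 qE; apply/eqP; ring.
rewrite (@Gamma_shift (1 + q - n%:R) n) ?subrK ?addr_gt0// revE.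
have q1 : 0 < 1 + q by rewrite addr_gt0.
have q1n : 0 < 1 + q + n%:R by rewrite ltr_wpDr.
have q21 : 0 < 2 * q + 1 by rewrite addr_gt0// mulr_gt0.
rewrite /Gamma q1n q21 -!gamE.
rewrite gam_prod ?addr_gt0// [1 + q]addrC /central.
rewrite !invfM invrK; ring.
Qed.

Lemma gseqS q n : 0 <= q -> (n%:R + 1 + q) * gseq q n.+1 = (n%:R - q) * gseq q n.
Proof.
move=> q0; rewrite !gseqE big_ord_recr/= exprS; field.
by rewrite gt_eqF// ltr_wpDr// ltr_wpDl.
Qed.

Lemma gseq0 q : gseq q 0 = - 2 * central q.
Proof. by rewrite gseqE big_ord0 expr0 !mulr1. Qed.

Lemma central_gt0 q : 0 <= q -> 0 < central q.
Proof.
move=> q0; have q1 : 0 < q + 1 by rewrite ltr_wpDl.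
have q21 : 0 < 2 * q + 1 by rewrite ltr_wpDl// mulr_ge0.
by rewrite divr_gt0 ?exprn_gt0 ?gam_gt0.
Qed.

Lemma central0 : central 0 = 1.
Proof. by rewrite /central mulr0 add0r gam1 expr1n divr1. Qed.

Lemma centralS q : 0 <= q -> (q + 1) * central (q + 1) = 2 * (2 * q + 1) * central q.
Proof.
move=> q0; have q1 : 0 < q + 1 by rewrite ltr_wpDl.
have q2 : 0 < 2 * q + 1 by rewrite ltr_wpDl// mulr_ge0.
rewrite /central (_ : 2 * (q + 1) + 1 = 2 * q + 1 + 1 + 1); last by ring.
have q21 : 0 < 2 * q + 1 + 1 by rewrite addr_gt0.
rewrite (gamS q1) (gamS q21) (gamS q2); field.
by rewrite !gt_eqF ?gam_gt0.
Qed.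

(** The numerator moves by 2q, which may exceed 1, hence two upper ratio bounds; the squared
    denominator takes one lower bound. The rational factor tends to 1 with N, leaving the growth 4^q
    that [chord_mean_le] also shows. *)
Lemma central_le q N : 0 <= q <= 1 ->
  central (N%:R + q) <= 4 `^ q * ((N%:R + 2) / (N%:R + 1)) ^+ 2 * central N%:R.
Proof.
move=> q01; have /andP[q0 q1] := q01; have : 0 <= N%:R :> R by [].
move: N%:R => n N0.
have n1 : 0 < n + 1 by lra.
have n2 : 0 < n + 2 by lra.
have n21 : 0 < 2 * n + 1 by lra.
have n21q : 0 < 2 * n + 1 + q by lra.
have eg1 : 0 < gam (n + 1) by exact: gam_gt0.
have eg2 : 0 < gam (2 * n + 1) by exact: gam_gt0.
have egq : 0 < gam (n + 1 + q) by apply: gam_gt0; lra.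
rewrite /central.
have -> : 2 * (n + q) + 1 = 2 * n + 1 + q + q by ring.
have -> : n + q + 1 = n + 1 + q by ring.
have up : gam (2 * n + 1 + q + q) <= (2 * (n + 1)) `^ q * (2 * (n + 1)) `^ q *
    gam (2 * n + 1).
  apply: le_trans (gam_ratio_le q01 n21q) _.
  rewrite -mulrA ler_pM ?powR_ge0 ?(ltW (gam_gt0 _))//.
    by rewrite ge0_ler_powR ?nnegrE//; lra.
  apply: le_trans (gam_ratio_le q01 n21) _.
  rewrite ler_wpM2r ?(ltW eg2)//.
  by rewrite ge0_ler_powR ?nnegrE//; lra.
have lo : (n + 1) / (n + 2) * (n + 2) `^ q * gam (n + 1) <= gam (n + 1 + q).
  apply: le_trans (gam_ratio_ge q01 n1).
  rewrite ler_wpM2r ?(ltW eg1)// -mulrA ler_wpM2l ?(ltW n1)//.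
  rewrite (_ : (n + 2)^-1 * (n + 2) `^ q = (n + 2) `^ (q - 1)); last first.
    by rewrite powRB ?powRr1 ?(ltW n2) ?(gt_eqF n2) ?implybT// mulrC.
  rewrite -[q - 1]opprB !powRN lef_pV2 ?posrE ?powR_gt0//; last by lra.
  by rewrite ge0_ler_powR ?nnegrE//; lra.
rewrite ler_pdivrMr ?exprn_gt0//; apply: le_trans up _.
set K := (n + 1) / (n + 2) * (n + 2) `^ q * gam (n + 1) in lo.
have K0 : 0 < K by rewrite !mulr_gt0 ?invr_gt0 ?powR_gt0.
apply: (@le_trans _ _ (4 `^ q * ((n + 2) / (n + 1)) ^+ 2 *
    (gam (2 * n + 1) / gam (n + 1) ^+ 2) * K ^+ 2)); last first.
  rewrite ler_wpM2l ?ler_pXn2r ?nnegrE ?(ltW K0) ?(ltW egq)//.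
  by rewrite !mulr_ge0 ?powR_ge0 ?invr_ge0 ?exprn_ge0 ?(ltW eg1) ?(ltW eg2)// ltW.
have -> : 4 `^ q * ((n + 2) / (n + 1)) ^+ 2 *
    (gam (2 * n + 1) / gam (n + 1) ^+ 2) * K ^+ 2 =
  4 `^ q * (n + 2) `^ q * (n + 2) `^ q * gam (2 * n + 1).
  by rewrite /K; field; rewrite !gt_eqF.
rewrite ler_wpM2r ?(ltW eg2)//.
rewrite (_ : 4 = 2 * 2 :> R); last by ring.
rewrite -!powRM ?mulr_ge0 ?(ltW n1) ?(ltW n2)//.
rewrite ge0_ler_powR ?nnegrE ?mulr_ge0 ?(ltW n1) ?(ltW n2)//; nra.
Qed.

Lemma central_ge q N : 0 <= q <= 1 ->
  4 `^ q * ((2 * N%:R + 1) / (2 * N%:R + 4)) ^+ 2 * central N%:R <= central (N%:R + q).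
Proof.
move=> q01; have /andP[q0 q1] := q01; have : 0 <= N%:R :> R by [].
move: N%:R => n N0.
have n1 : 0 < n + 1 by lra.
have n2 : 0 < n + 2 by lra.
have n21 : 0 < 2 * n + 1 by lra.
have n24 : 0 < 2 * n + 4 by lra.
have n21q : 0 < 2 * n + 1 + q by lra.
have eg1 : 0 < gam (n + 1) by exact: gam_gt0.
have eg2 : 0 < gam (2 * n + 1) by exact: gam_gt0.
have egq : 0 < gam (n + 1 + q) by apply: gam_gt0; lra.
(* The bound 2n + 4 serves for both shifts of the numerator and equals 2 (n + 2), so its power
   cancels against (n + 2)^q from the denominator up to 2^q. *)
have lo_pow y : 0 < y -> 2 * n + 1 <= y -> y + q <= 2 * n + 4 ->
    (2 * n + 1) / (2 * n + 4) * (2 * n + 4) `^ q <= y * (y + q) `^ (q - 1).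
  move=> y0 ny yz; have yq0 : 0 < y + q by lra.
  rewrite -mulrA ler_pM ?mulr_ge0 ?invr_ge0 ?powR_ge0 ?(ltW n24) ?(ltW n21)//.
  rewrite (_ : (2 * n + 4)^-1 * (2 * n + 4) `^ q = (2 * n + 4) `^ (q - 1)); last first.
    by rewrite powRB ?powRr1 ?(ltW n24) ?(gt_eqF n24) ?implybT// mulrC.
  rewrite -[q - 1]opprB !powRN lef_pV2 ?posrE ?powR_gt0//.
  by rewrite ge0_ler_powR ?nnegrE ?(ltW yq0) ?(ltW n24)//; lra.
set A := (2 * n + 1) / (2 * n + 4) * (2 * n + 4) `^ q in lo_pow.
have A0 : 0 < A by rewrite !mulr_gt0 ?invr_gt0 ?powR_gt0.
rewrite /central.
have -> : 2 * (n + q) + 1 = 2 * n + 1 + q + q by ring.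
have -> : n + q + 1 = n + 1 + q by ring.
have lo : A * (A * gam (2 * n + 1)) <= gam (2 * n + 1 + q + q).
  apply: le_trans (gam_ratio_ge q01 n21q).
  apply: ler_pM; [exact: ltW|by rewrite mulr_ge0 ?ltW|by apply: lo_pow; lra|].
  apply: le_trans (gam_ratio_ge q01 n21).
  by rewrite ler_wpM2r ?(ltW eg2)//; apply: lo_pow; lra.
have up : gam (n + 1 + q) <= (n + 2) `^ q * gam (n + 1).
  apply: le_trans (gam_ratio_le q01 n1) _.
  rewrite ler_wpM2r ?(ltW eg1)//.
  by rewrite ge0_ler_powR ?nnegrE//; lra.
rewrite ler_pdivlMr ?exprn_gt0//; apply: le_trans _ lo.
apply: (@le_trans _ _ (4 `^ q * ((2 * n + 1) / (2 * n + 4)) ^+ 2 *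
    (gam (2 * n + 1) / gam (n + 1) ^+ 2) *
    ((n + 2) `^ q * gam (n + 1)) ^+ 2)).
  rewrite ler_wpM2l ?ler_pXn2r ?nnegrE ?mulr_ge0 ?powR_ge0 ?invr_ge0 ?exprn_ge0
    ?(ltW eg1) ?(ltW eg2) ?(ltW egq) ?(ltW n21) ?(ltW n24)//.
rewrite le_eqVlt; apply/orP; left; apply/eqP.
have -> : A = (2 * n + 1) / (2 * n + 4) * (2 `^ q * (n + 2) `^ q).
  by rewrite /A -powRM ?(ltW n2)// (_ : 2 * (n + 2) = 2 * n + 4)//; ring.
rewrite (_ : 4 = 2 * 2 :> R); last by ring.
rewrite powRM//; field.
by rewrite !gt_eqF.
Qed.

End gamma_coefficients.

(** * The mean of a power of the chord is a central binomial coefficient *)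

Section chord_power_mean.
Context {R : realType}.
Implicit Types (x y t q h : R) (n m N : nat).
Notation mu := (@lebesgue_measure R).
Notation T := (`[0, 2 * pi]%classic : set R).

Lemma pi2_gt0 : 0 < 2 * pi :> R.
Proof. by rewrite mulr_gt0 ?pi_gt0. Qed.

Lemma mu_T : mu T = (2 * pi)%:E.
Proof. by rewrite lebesgue_measure_itv/= lte_fin pi2_gt0 oppr0 adde0. Qed.

Lemma continuous_integrable (f : R -> R) (a b : R) :
  continuous f -> mu.-integrable `[a, b] (EFin \o f).
Proof.
move=> cf; apply: continuous_compact_integrable; first exact: segment_compact.
exact: continuous_subspaceT.
Qed.

Definition chord2 h : R := 2 - 2 * cos h.

Lemma chord2_ge0 h : 0 <= chord2 h.
Proof. by have := cos_le1 h; rewrite /chord2; lra. Qed.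

Lemma chord2_le4 h : chord2 h <= 4.
Proof. by have := cos_geN1 h; rewrite /chord2; lra. Qed.

Lemma chord2_gt0 h : 0 < h < 2 * pi -> 0 < chord2 h.
Proof.
move=> /andP[h0 h2].
have s0 : 0 < sin (h / 2).
  by apply: sin_gt0_pi; rewrite divr_gt0//= ltr_pdivrMr// mulrC.
have -> : chord2 h = 4 * sin (h / 2) ^+ 2.
  rewrite /chord2 {1}(_ : h = (h / 2) *+ 2); last by rewrite -mulr_natr divfK.
  by rewrite cos_mulr2n sin2cos2; ring.
by rewrite mulr_gt0// exprn_gt0.
Qed.

Lemma is_derive_chord2 h : is_derive h 1 chord2 (2 * sin h).
Proof. by apply: is_derive_eq; rewrite /GRing.scale/=; ring. Qed.

Lemma continuous_chord2 : continuous chord2.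
Proof.
move=> h; apply: differentiable_continuous; apply/derivable1_diffP.
by apply: ex_derive; exact: is_derive_chord2.
Qed.

(** Without the absolute value the power jumps at 0 for q > 0, since on negative bases [ln] is 0 and
    the power is 1. *)
Lemma continuous_norm_powR q : 0 <= q -> continuous (fun x : R => `|x| `^ q).
Proof.
rewrite le_eqVlt => /predU1P[<-|q0] x.
  under eq_fun do rewrite powRr0.
  exact: cvg_cst.
have [->|x0] := eqVneq x 0.
  rewrite /continuous_at normr0 powR0 ?gt_eqF//.
  apply/cvgrPdist_lt => e e0; near=> y.
  rewrite sub0r normrN ger0_norm ?powR_ge0//.
  have -> : e = (e `^ q^-1) `^ q by rewrite -powRrM mulVf ?gt_eqF// powRr1 ?ltW.
  rewrite gt0_ltr_powR ?nnegrE ?powR_ge0//.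
  rewrite -[y]subr0 distrC; near: y.
  by apply: cvgr_dist_lt => //; rewrite powR_gt0.
apply: (@continuous_comp _ _ _ (fun y : R => `|y|) (fun y : R => y `^ q)).
  exact: norm_continuous.
apply: differentiable_continuous; apply/derivable1_diffP.
by apply: ex_derive; apply: is_derive1_powR; rewrite normr_gt0.
Unshelve. all: by end_near. Qed.

Lemma continuous_chord2_powR q : 0 <= q -> continuous (fun h => chord2 h `^ q).
Proof.
move=> q0 h.
rewrite (_ : (fun h => _) = (fun x : R => `|x| `^ q) \o chord2); last first.
  by apply/funext => x /=; rewrite ger0_norm ?chord2_ge0.
apply: continuous_comp; [exact: continuous_chord2|exact: continuous_norm_powR].
Qed.

Definition chord_mean q : R := (2 * pi)^-1 * \int[mu]_(h in T) (chord2 h `^ q).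

(** The function [chord2 h ^ q * sin h] vanishes at both ends, and its derivative combines the
    powers q and q + 1 of [chord2], because sin^2 = chord2 - chord2^2 / 4. *)
Lemma chord_meanS q : 0 <= q ->
  (q + 1) * chord_mean (q + 1) = 2 * (2 * q + 1) * chord_mean q.
Proof.
move=> q0; have q10 : 0 <= q + 1 by rewrite addr_ge0.
have cF : continuous (fun h => chord2 h `^ q * sin h).
  move=> h; apply: cvgM; first exact: continuous_chord2_powR.
  exact: continuous_sin.
pose f h := (2 * q + 1) * chord2 h `^ q - (q + 1) / 2 * chord2 h `^ (q + 1).
have c1 : continuous (fun h => (2 * q + 1) * chord2 h `^ q).
  by move=> h; apply: cvgM; [exact: cvg_cst|exact: continuous_chord2_powR].
have c2 : continuous (fun h => (q + 1) / 2 * chord2 h `^ (q + 1)).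
  by move=> h; apply: cvgM; [exact: cvg_cst|exact: continuous_chord2_powR].
have cf : continuous f by move=> h; apply: cvgB; [exact: c1|exact: c2].
have dF h : 0 < h < 2 * pi -> is_derive h 1 (fun h => chord2 h `^ q * sin h) (f h).
  move=> hT; have s0 := chord2_gt0 hT.
  have d1 := is_derive1_powR q s0.
  have d2 : is_derive h 1 (fun x => chord2 x `^ q) (2 * sin h * (q * chord2 h `^ (q - 1))).
    have d3 := is_derive_chord2 h.
    by apply: is_derive_eq (is_derive1_comp d1 d3) _; rewrite /GRing.scale/=; ring.
  apply: is_derive_eq; rewrite /GRing.scale/= /f.
  have -> : chord2 h `^ q = chord2 h `^ (q - 1) * chord2 h.
    by rewrite -{3}(powRr1 (ltW s0)) -powRD ?subrK// (gt_eqF s0) implybT.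
  have -> : chord2 h `^ (q + 1) = chord2 h `^ (q - 1) * chord2 h ^+ 2.
    rewrite -powR_mulrn ?(ltW s0)// -powRD ?(gt_eqF s0) ?implybT//; congr (_ `^ _); ring.
  have -> : sin h * (2 * sin h * (q * chord2 h `^ (q - 1))) =
      2 * (sin h ^+ 2) * (q * chord2 h `^ (q - 1)) by ring.
  by rewrite sin2cos2 /chord2; field.
have := @Rintegral_derive _ _ _ _ _ pi2_gt0 (continuous_subspaceT cf)
  (continuous_subspaceT cF) dF.
rewrite mulr_natl sin2pi sin0 !mulr0 subrr -mulr_natl.
rewrite RintegralB//; [|exact: continuous_integrable..].
rewrite !RintegralZl//; [|exact/continuous_integrable/continuous_chord2_powR..].
rewrite /chord_mean => /eqP; rewrite subr_eq0 => /eqP E.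
move: ((2 * pi)^-1) (Rintegral _ _ _) (Rintegral _ _ _) E => c I1 I2 E.
rewrite [RHS](_ : _ = 2 * c * ((2 * q + 1) * I2)); last by ring.
by rewrite E; field.
Qed.

Lemma chord_mean0 : chord_mean 0 = 1.
Proof.
rewrite /chord_mean; under eq_Rintegral do rewrite powRr0.
rewrite Rintegral_cst//= lebesgue_measure_itv/= lte_fin pi2_gt0/= subr0 mul1r mulVf//.
by rewrite gt_eqF// pi2_gt0.
Qed.

Lemma chord_mean_le q r : 0 <= q -> 0 <= r -> chord_mean (q + r) <= 4 `^ r * chord_mean q.
Proof.
move=> q0 r0; rewrite /chord_mean mulrCA ler_wpM2l ?invr_ge0 ?(ltW pi2_gt0)//.
rewrite -RintegralZl//; last exact/continuous_integrable/continuous_chord2_powR.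
apply: le_Rintegral => //.
- by apply/continuous_integrable/continuous_chord2_powR; rewrite addr_ge0.
- apply/continuous_integrable => h; apply: cvgM; first exact: cvg_cst.
  exact: continuous_chord2_powR.
move=> h _; have := chord2_ge0 h; rewrite le_eqVlt => /predU1P[<-|s0].
  have [->|r0'] := eqVneq r 0; first by rewrite addr0 powRr0 mul1r.
  rewrite powR0 ?mulr_ge0 ?powR_ge0// gt_eqF// ltr_wpDl// lt0r r0'//.
rewrite powRD; last by rewrite (gt_eqF s0) implybT.
rewrite mulrC ler_wpM2r ?powR_ge0//.
by rewrite ge0_ler_powR ?nnegrE ?(ltW s0) ?chord2_le4.
Qed.

(** At natural numbers the recurrence gives positivity; [chord_mean_le] from q up to an integer N >
    q carries it back to q. *)
Lemma chord_mean_gt0 q : 0 <= q -> 0 < chord_mean q.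
Proof.
move=> q0.
have pos N : 0 < chord_mean N%:R.
  elim: N => [|N IH]; first by rewrite chord_mean0.
  rewrite -natr1 -(pmulr_rgt0 _ (ltr_wpDl (ler0n _ N) ltr01)) chord_meanS//.
  by apply: mulr_gt0 => //; apply: mulr_gt0 => //; rewrite ltr_wpDl// mulr_ge0.
pose N := Num.bound q.
have qN : q <= N%:R by rewrite ltW// unstable.ltr_bound.
have := @chord_mean_le q (N%:R - q) q0; rewrite subr_ge0 addrC subrK => /(_ qN).
by move=> /(lt_le_trans (pos N)); rewrite pmulr_rgt0// powR_gt0.
Qed.

Let ratio q := central q / chord_mean q.

Let ratio_nat q N : 0 <= q -> ratio (N%:R + q) = ratio q.
Proof.
move=> q0; elim: N => [|N IH]; first by rewrite add0r.
rewrite -natr1 addrAC -IH /ratio; set x := N%:R + q.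
have x0 : 0 <= x by rewrite addr_ge0.
have x1 : 0 < x + 1 by rewrite ltr_wpDl.
have w1 := chord_mean_gt0 x0.
have w2 : 0 < chord_mean (x + 1) by rewrite chord_mean_gt0// ltW.
have e1 : central (x + 1) = 2 * (2 * x + 1) / (x + 1) * central x.
  by apply: (mulfI (lt0r_neq0 x1)); rewrite centralS//; field; rewrite gt_eqF.
have e2 : chord_mean (x + 1) = 2 * (2 * x + 1) / (x + 1) * chord_mean x.
  by apply: (mulfI (lt0r_neq0 x1)); rewrite chord_meanS//; field; rewrite gt_eqF.
have x21 : 0 < 2 * x + 1 by rewrite ltr_wpDl// mulr_ge0.
by rewrite e1 e2; field; rewrite !gt_eqF.
Qed.

Let ratio0 : ratio 0 = 1.
Proof. by rewrite /ratio central0 chord_mean0 divr1. Qed.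

Let ratio1 q : 0 <= q <= 1 -> ratio q = 1.
Proof.
move=> q01; have /andP[q0 q1] := q01.
have cN N : central N%:R = chord_mean N%:R.
  have := @ratio_nat 0 N (lexx _); rewrite addr0 ratio0 /ratio => /divr1_eq; exact.
(* The mean at N + q is bounded below by going up to N + 1 with [chord_mean_le]; the recurrence then
   returns to N, where mean and [central] agree. *)
have up N : ratio q <= ((N%:R + 2) / (N%:R + 1)) ^+ 2 * ((2 * N%:R + 2) / (2 * N%:R + 1)).
  rewrite -(ratio_nat N q0) /ratio; have N0 : 0 <= N%:R :> R by [].
  have w1 : 0 < chord_mean (N%:R + q) by rewrite chord_mean_gt0// addr_ge0.
  rewrite ler_pdivrMr//; apply: le_trans (central_le N q01) _.
  have := @chord_mean_le (N%:R + q) (1 - q); rewrite addr_ge0// subr_ge0 q1.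
  rewrite (_ : N%:R + q + (1 - q) = N%:R + 1); last by ring.
  move=> /(_ isT isT); have := @chord_meanS N%:R N0; rewrite cN.
  move: (N%:R) N0 w1 (chord_mean (N%:R + 1)) => n n0 w1 W wS.
  have n1 : 0 < n + 1 by lra.
  have n21 : 0 < 2 * n + 1 by lra.
  have -> : W = 2 * (2 * n + 1) / (n + 1) * chord_mean n.
    by apply: (mulfI (lt0r_neq0 n1)); rewrite wS; field; rewrite gt_eqF.
  have p4 : 0 < 4 `^ q :> R by rewrite powR_gt0.
  have -> : 4 `^ (1 - q) = 4 / 4 `^ q :> R.
    by rewrite powRB ?powRr1// (gt_eqF (ltr0n _ 4)) implybT.
  move=> h.
  have {}h : 4 `^ q * chord_mean n <= (2 * n + 2) / (2 * n + 1) * chord_mean (n + q).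
    rewrite -(ler_pM2l (_ : 0 < 2 * (2 * n + 1) / (n + 1) / 4 `^ q)); last first.
      by rewrite !mulr_gt0 ?invr_gt0.
    rewrite [leLHS](_ : _ = 2 * (2 * n + 1) / (n + 1) * chord_mean n); last first.
      by field; rewrite !gt_eqF.
    apply: le_trans h _; rewrite le_eqVlt; apply/orP; left; apply/eqP.
    by field; rewrite !gt_eqF//; lra.
  have E0 : 0 <= ((n + 2) / (n + 1)) ^+ 2 by rewrite exprn_ge0// divr_ge0//; lra.
  have := ler_wpM2l E0 h.
  move: (((n + 2) / (n + 1)) ^+ 2) ((2 * n + 2) / (2 * n + 1)) => E F.
  by rewrite !mulrA [_ * E]mulrC.
have lo N : ((2 * N%:R + 1) / (2 * N%:R + 4)) ^+ 2 <= ratio q.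
  rewrite -(ratio_nat N q0) /ratio; have N0 : 0 <= N%:R :> R by [].
  have w1 : 0 < chord_mean (N%:R + q) by rewrite chord_mean_gt0// addr_ge0.
  rewrite ler_pdivlMr//; apply: le_trans _ (central_ge N q01).
  rewrite cN [4 `^ q * _]mulrC -[leRHS]mulrA ler_wpM2l ?exprn_ge0 ?divr_ge0 ?addr_ge0 ?mulr_ge0//.
  exact: chord_mean_le.
have lim1 (c : R) : (fun n => 1 + c * n.+1%:R^-1) @ \oo --> (1 : R).
  rewrite -[X in _ --> X]addr0 -[X in _ --> _ + X](mulr0 c).
  by apply: cvgD; [exact: cvg_cst|apply: cvgMr; exact: cvg_harmonic].
apply/eqP; rewrite eq_le; apply/andP; split.
(* Each of the three factors in [up] is at most 1 + 1/(N + 1). *)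
- apply: (@cvgr_to_ge _ \oo _ _ (fun n => (1 + 1 * n.+1%:R^-1) * (1 + 1 * n.+1%:R^-1) *
      (1 + 1 * n.+1%:R^-1) : R)).
    by have := cvgM (cvgM (lim1 1) (lim1 1)) (lim1 1); rewrite !mulr1; apply.
  near=> N; apply: le_trans (up N) _; rewrite mul1r -expr2.
  have N0 : 0 <= N%:R :> R by [].
  have -> : N.+1%:R^-1 = (N%:R + 1)^-1 :> R by rewrite natr1.
  move: (N%:R) N0 => n n0.
  have n1 : 0 < n + 1 by lra.
  have n21 : 0 < 2 * n + 1 by lra.
  rewrite ler_pM ?exprn_ge0 ?divr_ge0 ?(ltW n1) ?(ltW n21)//; [lra|lra| |].
    rewrite ler_pXn2r ?nnegrE ?divr_ge0 ?addr_ge0 ?invr_ge0 ?(ltW n1)//.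
    rewrite ler_pdivrMr// mulrDl mul1r mulVf ?gt_eqF//; lra.
  have v0 : 0 < (n + 1)^-1 by rewrite invr_gt0.
  have nv : n * (n + 1)^-1 = 1 - (n + 1)^-1.
    by apply/eqP; rewrite -subr_eq opprK -{2}[_^-1]mul1r -mulrDl divff// gt_eqF.
  have nv0 : 0 <= n * (n + 1)^-1 by rewrite mulr_ge0// ltW.
  move: ((n + 1)^-1) v0 nv nv0 => v v0 nv nv0.
  by rewrite ler_pdivrMr//; nra.
(* The factor in [lo] at n = N + 1 is 1 - 3/(2n + 4), at least 1 - 3/(2n). *)
- apply: (@cvgr_to_le _ \oo _ _ (fun n => (1 + (- (3 / 2)) * n.+1%:R^-1) *
      (1 + (- (3 / 2)) * n.+1%:R^-1) : R)).
    by have := cvgM (lim1 (- (3 / 2))) (lim1 (- (3 / 2))); rewrite mulr1; apply.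
  near=> N; apply: le_trans _ (lo N.+1); rewrite mulNr -expr2.
  have N0 : 0 <= N.+1%:R :> R by [].
  have N1 : 1 <= N.+1%:R :> R by rewrite ler1n.
  move: (N.+1%:R) N0 N1 => n n0 n1.
  have n00 : 0 < n by lra.
  have n24 : 0 < 2 * n + 4 by lra.
  have v0 : 0 < n^-1 by rewrite invr_gt0.
  have nv : n * n^-1 = 1 by rewrite divff ?gt_eqF.
  move: (n^-1) v0 nv => v v0 nv.
  have v1 : v <= 1 by nra.
  have h1 : 1 - 3 / 2 * v <= (2 * n + 1) / (2 * n + 4) by rewrite ler_pdivlMr//; nra.
  (* The smaller root can be as low as -1/2, so comparing the squares needs the larger one to be at
     least 1/2. *)
  have h2 : 2^-1 <= (2 * n + 1) / (2 * n + 4) by rewrite ler_pdivlMr//; lra.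
  by rewrite -subr_ge0 subr_sqr mulr_ge0//; lra.
Unshelve. all: by end_near. Qed.

Lemma central_chord_mean q : 0 <= q -> central q = chord_mean q.
Proof.
move=> q0.
have [N [r [r01 qE]]] : exists N r, 0 <= r <= 1 /\ q = N%:R + r.
  exists (Num.truncn q), (q - (Num.truncn q)%:R); split; last by rewrite addrC subrK.
  by have /andP[h1 h2] := truncn_itv q0; rewrite subr_ge0 h1/= lerBlDl natr1 ltW.
have /andP[r0 _] := r01.
by have := ratio_nat N r0; rewrite -qE (ratio1 r01) /ratio => /divr1_eq.
Qed.

End chord_power_mean.

(** * Cosines of positive integer frequency have mean zero *)

Section trigonometric_periods.
Context {R : realType}.
Implicit Types n : nat.
Notation mu := (@lebesgue_measure R).
Notation T := (`[0, 2 * pi]%classic : set R).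

Lemma cos_nat2pi n : cos (n%:R * (2 * pi)) = 1 :> R.
Proof.
have := periodicn (@cosD2pi R) n 0; rewrite add0r cos0.
by rewrite (mulr_natl _ n) (mulr_natl pi 2).
Qed.

Lemma sin_nat2pi n : sin (n%:R * (2 * pi)) = 0 :> R.
Proof.
have := periodicn (@sinD2pi R) n 0; rewrite add0r sin0.
by rewrite (mulr_natl _ n) (mulr_natl pi 2).
Qed.

Lemma Rintegral_cos_nat n : (0 < n)%N -> \int[mu]_(h in T) cos (n%:R * h) = 0.
Proof.
move=> n0; have n0' : n%:R != 0 :> R by rewrite pnatr_eq0 -lt0n.
have c1 : continuous (fun h : R => cos (n%:R * h)).
  by move=> h; apply: continuous_comp; [exact: mulrl_continuous|exact: continuous_cos].
have c2 : continuous (fun h : R => sin (n%:R * h) / n%:R).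
  move=> h; apply: cvgMl.
  by apply: continuous_comp; [exact: mulrl_continuous|exact: continuous_sin].
have dF h : 0 < h < 2 * pi -> is_derive h 1 (fun h : R => sin (n%:R * h) / n%:R) (cos (n%:R * h)).
  by move=> _; apply: is_derive_eq; rewrite /GRing.scale/=; field.
rewrite (Rintegral_derive pi2_gt0 (continuous_subspaceT c1) (continuous_subspaceT c2) dF).
by rewrite sin_nat2pi mulr0 sin0 mul0r subrr.
Qed.

End trigonometric_periods.

(** * The cosine expansion of the chord power *)

Section power_series.
Context {R : realType}.
Implicit Types (x y t h : R) (n m N M : nat).
Notation mu := (@lebesgue_measure R).
Notation T := (`[0, 2 * pi]%classic : set R).
Variable q : R.
Hypothesis q_gt : 1 / 2 < q.
Local Notation g := (gseq q).

Let q0 : 0 < q. Proof. by move: q_gt; lra. Qed.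

(** A telescoping majorant: with T n = n (n + q) |g n|, the recurrence gives T n - T (n + 1) = ((2q
    - 1) n + q) |g n| once n > q, and 2q - 1 > 0. *)
Lemma gseq_weighted_bound : exists C, forall M, \sum_(n < M) n%:R * `|g n| <= C.
Proof.
pose N0 := Num.bound q.
have qN0 : q < N0%:R by exact: unstable.ltr_bound.
pose Tn n := n%:R * (n%:R + q) * `|g n|.
have Tn0 n : 0 <= Tn n by rewrite !mulr_ge0 ?addr_ge0 ?(ltW q0).
have step n : (N0 <= n)%N -> (2 * q - 1) * (n%:R * `|g n|) <= Tn n - Tn n.+1.
  move=> N0n; have qn : q < n%:R by rewrite (lt_le_trans qN0)// ler_nat.
  have E : (n%:R + 1 + q) * `|g n.+1| = (n%:R - q) * `|g n|.
    have := congr1 Num.norm (gseqS n (ltW q0)); rewrite !normrM.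
    rewrite (ger0_norm (_ : 0 <= n%:R - q)) ?subr_ge0 ?(ltW qn)//.
    by rewrite ger0_norm// !addr_ge0 ?(ltW q0).
  have -> : Tn n.+1 = (n%:R + 1) * ((n%:R - q) * `|g n|) by rewrite /Tn -natr1 -mulrA E.
  rewrite -subr_ge0 (_ : _ - _ = q * `|g n|); last by rewrite /Tn; ring.
  by rewrite mulr_ge0// ltW.
have c0 : 0 < 2 * q - 1 by move: q_gt; lra.
pose C := \sum_(n < N0) n%:R * `|g n| + Tn N0 / (2 * q - 1).
have big j : \sum_(n < N0 + j) n%:R * `|g n| <= C - Tn (N0 + j)%N / (2 * q - 1).
  elim: j => [|j IH]; first by rewrite addn0 /C addrK.
  rewrite addnS big_ord_recr/=.
  apply: le_trans (lerD IH (lexx _)) _.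
  have := step (N0 + j)%N (leq_addr _ _); rewrite -ler_pdivlMl// => h.
  apply: le_trans (lerD (lexx _) h) _.
  by rewrite mulrBr [_^-1 * Tn (N0 + j)%N]mulrC [_^-1 * _]mulrC addrA addrNK.
exists C => M.
apply: (@le_trans _ _ (\sum_(n < N0 + M) n%:R * `|g n|)).
  rewrite addnC big_split_ord/= lerDl sumr_ge0//.
by apply: le_trans (big M) _; rewrite gerBl divr_ge0 ?(ltW c0).
Qed.

Lemma cvg_gseq_weighted : cvgn (series (fun n => n%:R * `|g n|)).
Proof.
have [C hC] := gseq_weighted_bound.
apply: nondecreasing_is_cvgn.
  by apply/nondecreasing_series => n _ _; rewrite mulr_ge0.
by exists C => _ [M _ <-]; rewrite /series/= big_mkord.
Qed.

Lemma cvg_normed_gseq : cvgn (series (fun n => `|g n|)).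
Proof.
have [C hC] := gseq_weighted_bound.
apply: nondecreasing_is_cvgn.
  by apply/nondecreasing_series => n _ _.
exists (`|g 0%N| + C) => _ [M _ <-]; rewrite /series/= big_mkord.
apply: (@le_trans _ _ (\sum_(n < M.+1) `|g n|)).
  by rewrite big_ord_recr/= lerDl.
rewrite big_ord_recl lerD//; apply: le_trans (hC M.+1).
rewrite [leRHS]big_ord_recl/= mul0r add0r; apply: ler_sum => i _.
by rewrite /bump/= add1n ler_peMl// ler1n.
Qed.

Lemma gseq_weighted_cvg0 : (fun n => (n%:R + q) * `|g n|) @ \oo --> (0 : R).
Proof.
have h1 := cvg_series_cvg_0 cvg_gseq_weighted.
have h2 := cvg_series_cvg_0 cvg_normed_gseq.
have h3 : (fun n => n%:R * `|g n| + q * `|g n|) @ \oo --> (0 + q * 0 : R).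
  by apply: cvgD => //; apply: cvgMr.
by move: h3; under eq_fun do rewrite -mulrDl; rewrite mulr0 addr0.
Qed.

(** The sum includes n = 0, so for N >= 1 the constant term is - g 0 / 2 = [central q], the mean of
    the function to be expanded. *)
Definition psum N h : R := g 0%N / 2 - \sum_(n < N) g n * cos (n%:R * h).

Definition dpsum N h : R := \sum_(n < N) n%:R * g n * sin (n%:R * h).

Let is_derive_S N h : is_derive h 1 (psum N) (dpsum N h).
Proof.
rewrite /dpsum -[X in is_derive _ _ _ X]opprK -sumrN -[X in is_derive _ _ _ X]add0r.
have -> : psum N = cst (g 0%N / 2) - \sum_(n < N) (fun x => g n * cos (n%:R * x)).
  by apply/funext => x; rewrite /psum !fctE; congr (_ - _); rewrite fct_sumE.
apply: is_deriveB; apply: is_derive_sum => i.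
by apply: is_derive_eq; rewrite /GRing.scale/=; ring.
Qed.

(** By [gseqS] consecutive indices cancel, so truncation leaves one boundary term, of size at most
    (N + q) |g N|, which tends to 0 by [gseq_weighted_cvg0]. *)
Let S_ode N h : (1 - cos h) * dpsum N h - q * sin h * psum N h =
  - ((N%:R + q) / 2 * g N * (sin (N%:R * h) - sin (N%:R * h - h))).
Proof.
elim: N => [|N IH].
  by rewrite /dpsum /psum !big_ord0 mul0r sub0r sin0 sinN; field.
have -> : dpsum N.+1 h = dpsum N h + N%:R * g N * sin (N%:R * h).
  by rewrite /dpsum big_ord_recr.
have -> : psum N.+1 h = psum N h - g N * cos (N%:R * h).
  by rewrite /psum big_ord_recr/= opprD addrA.
have gN : (N.+1%:R + q) * g N.+1 = (N%:R - q) * g N.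
  by rewrite -gseqS ?(ltW q0)// -natr1.
rewrite (_ : N.+1%:R * h - h = N%:R * h); last by rewrite -natr1; ring.
rewrite (_ : N.+1%:R * h = N%:R * h + h); last by rewrite -natr1; ring.
rewrite sinD; rewrite sinB in IH.
rewrite (_ : (N.+1%:R + q) / 2 * g N.+1 = (N.+1%:R + q) * g N.+1 / 2); last by ring.
rewrite gN.
transitivity ((1 - cos h) * dpsum N h - q * sin h * psum N h +
  g N * (N%:R * sin (N%:R * h) * (1 - cos h) + q * sin h * cos (N%:R * h))); first by ring.
by rewrite IH; field.
Qed.

Definition glim h : R := limn (fun N => psum N h).

Definition gabs : R := limn (series (fun n => `|g n|)).

Let S_sub N h x : psum N h - psum N x = \sum_(n < N) g n * (cos (n%:R * x) - cos (n%:R * h)).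
Proof.
rewrite /psum opprB addrC addrA subrK -sumrB.
by apply: eq_bigr => i _; rewrite mulrBr.
Qed.

Let S_dist N M h : (N <= M)%N ->
  `|psum M h - psum N h| <= series (fun n => `|g n|) M - series (fun n => `|g n|) N.
Proof.
move=> NM; have [j ->] : exists j, M = (N + j)%N by exists (M - N)%N; rewrite subnKC.
elim: j => [|j IH]; first by rewrite addn0 !subrr normr0.
have -> : psum (N + j.+1)%N h = psum (N + j)%N h - g (N + j)%N * cos ((N + j)%:R * h).
  by rewrite addnS /psum big_ord_recr/= opprD addrA.
have -> : series (fun n => `|g n|) (N + j.+1)%N = series (fun n => `|g n|) (N + j)%N + `|g (N + j)%N|.
  by rewrite addnS /series/= big_nat_recr.
rewrite addrAC (le_trans (ler_normB _ _))// [leRHS]addrAC lerD//.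
by rewrite normrM ler_piMr// cos_max.
Qed.

Let S_cvg h : psum ^~ h @ \oo --> glim h.
Proof.
suff : cvgn (fun N => psum N h) by [].
apply: is_cvgB; first exact: is_cvg_cst.
have -> : (fun N => \sum_(n < N) g n * cos (n%:R * h)) =
    series (fun n => g n * cos (n%:R * h)).
  by apply/funext => N; rewrite /series/= big_mkord.
apply: normed_cvg; apply: (series_le_cvg _ _ _ cvg_normed_gseq) => n //=.
by rewrite normrM ler_piMr// cos_max.
Qed.

Let S_G_dist N h : `|psum N h - glim h| <= gabs - series (fun n => `|g n|) N.
Proof.
rewrite distrC.
apply: (@cvgr_to_le _ \oo _ _ (fun M => `|psum M h - psum N h|)).
  by apply: cvg_norm; apply: cvgB; [exact: S_cvg|exact: cvg_cst].
near=> M; have NM : (N <= M)%N by near: M; exact: nbhs_infty_ge.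
apply: le_trans (S_dist h NM) _; rewrite lerB//.
apply: nondecreasing_cvgn_le; last exact: cvg_normed_gseq.
by apply/nondecreasing_series => n _ _.
Unshelve. all: by end_near. Qed.

Let cos_lip x y : `|cos x - cos y| <= `|x - y|.
Proof.
wlog xy : x y / y <= x.
  by move=> H; case: (leP y x) => [/H//|/ltW/H]; rewrite distrC [leRHS]distrC.
have [|c _ ->] := @MVT_segment R cos (fun z => - sin z) y x xy.
  exact/continuous_subspaceT/continuous_cos.
by rewrite normrM normrN ler_piMl// sin_max.
Qed.

(** Supplies the continuity of the limit at 0, an endpoint that [G_F_ratio] does not reach. *)
Let G_lip : exists C, forall h, `|glim h - glim 0| <= C * `|h|.
Proof.
have [C hC] := gseq_weighted_bound; exists C => h.
apply: (@cvgr_to_le _ \oo _ _ (fun M => `|psum M h - psum M 0|)).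
  by apply: cvg_norm; apply: cvgB; exact: S_cvg.
near=> M; rewrite S_sub.
apply: le_trans (ler_norm_sum _ _ _) _.
apply: (@le_trans _ _ ((\sum_(n < M) n%:R * `|g n|) * `|h|)); last first.
  by rewrite ler_wpM2r.
rewrite mulr_suml; apply: ler_sum => i _; rewrite mulr0 normrM.
rewrite [_ * `|g i|]mulrC -mulrA ler_wpM2l// (le_trans (cos_lip _ _))//.
by rewrite sub0r normrN normrM normr_nat.
Unshelve. all: by end_near. Qed.

Local Notation F h := (chord2 h `^ q).

(* psum N / F has derivative O((N + q) g N) away from 0, so its limit is constant. *)
Let G_F_ratio a b : 0 < a -> a < b -> b < 2 * pi -> glim b / F b = glim a / F a.
Proof.
move=> a0 ab b2.
have posc x : a <= x <= b -> 0 < chord2 x.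
  by move=> /andP[ax xb]; rewrite chord2_gt0// (lt_le_trans a0)// (le_lt_trans xb).
have [c] := @EVT_min R chord2 a b (ltW ab) (continuous_subspaceT continuous_chord2).
rewrite in_itv/= => /posc; set m := chord2 c => m0 hm.
pose H N x := psum N x * chord2 x `^ (- q).
pose dH N x := 2 * chord2 x `^ (- q - 1) *
  - ((N%:R + q) / 2 * g N * (sin (N%:R * x) - sin (N%:R * x - x))).
have dHE N x : a <= x <= b -> is_derive x 1 (H N) (dH N x).
  move=> /posc x0; have d1 := is_derive1_powR (- q) x0.
  have d3 := is_derive_chord2 x; have d2 := is_derive1_comp d1 d3.
  have d4 := is_derive_S N x.
  apply: is_derive_eq (is_deriveM d4 d2) _.
  rewrite /dH -S_ode /GRing.scale/=.
  have -> : chord2 x `^ (- q) = chord2 x `^ (- q - 1) * chord2 x.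
    by rewrite -{3}(powRr1 (ltW x0)) -powRD ?subrK// (gt_eqF x0) implybT.
  have cE : chord2 x = 2 * (1 - cos x) by rewrite /chord2; ring.
  by move: (chord2 x `^ (- q - 1)) => B; rewrite cE; ring.
have bound N : `|H N b - H N a| <= 2 * m `^ (- q - 1) * (b - a) * ((N%:R + q) * `|g N|).
  have [||x xab ->] := @MVT_segment R (H N) (dH N) a b (ltW ab).
  - by move=> x; rewrite in_itv/= => /andP[ax xb]; apply: dHE; rewrite !ltW.
  - by apply: derive_continuous_within => x xab; exact: dHE.
  rewrite normrM (gtr0_norm (_ : 0 < b - a)) ?subr_gt0// mulrAC ler_wpM2r ?subr_ge0 ?(ltW ab)//.
  rewrite /dH normrM ger0_norm ?mulr_ge0 ?powR_ge0// normrN normrM normrM.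
  have x0 := posc _ xab.
  have mx : m <= chord2 x by apply: hm.
  rewrite -[leLHS]mulrA -[leRHS]mulrA ler_wpM2l// ler_pM ?mulr_ge0 ?powR_ge0//.
    rewrite -opprD !powRN lef_pV2 ?posrE ?powR_gt0//.
    have q10 : 0 <= q + 1 by rewrite addr_ge0// ltW.
    by rewrite ge0_ler_powR ?nnegrE ?(ltW m0) ?(ltW x0).
  rewrite (@ger0_norm _ (_ / 2)) ?divr_ge0 ?addr_ge0 ?(ltW q0)//.
  have s2 : `|sin (N%:R * x) - sin (N%:R * x - x)| <= 2.
    by rewrite (le_trans (ler_normB _ _))// (_ : 2 = 1 + 1)// lerD// sin_max.
  rewrite (_ : (N%:R + q) * `|g N| = (N%:R + q) / 2 * `|g N| * 2); last by field.
  by rewrite ler_wpM2l// mulr_ge0// divr_ge0// addr_ge0// ltW.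
have lim0 : (fun N => H N b - H N a) @ \oo --> (0 : R).
  apply/cvgr0Pnorm_le => /= e e0; near=> N; apply: le_trans (bound N) _.
  near: N; set k := _ * (b - a).
  have : (fun N => k * ((N%:R + q) * `|g N|)) @ \oo --> (0 : R).
    by rewrite -[X in _ --> X](mulr0 k); apply: cvgMr; exact: gseq_weighted_cvg0.
  by move=> /cvgr0_norm_le/(_ e e0); apply: filterS => n /(le_trans (ler_norm _)).
have limG : (fun N => H N b - H N a) @ \oo --> glim b * chord2 b `^ (- q) - glim a * chord2 a `^ (- q).
  by apply: cvgB; apply: cvgMl; exact: S_cvg.
have : 0 = glim b * chord2 b `^ (- q) - glim a * chord2 a `^ (- q).
  by apply: (cvg_unique _ lim0 limG).
by rewrite !powRN => /esym/eqP; rewrite subr_eq0 => /eqP.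
Unshelve. all: by end_near. Qed.

Definition gratio : R := glim pi / F pi.

Let pi_lt : (pi : R) < 2 * pi.
Proof. by rewrite ltr_pMl ?pi_gt0// ltr1n. Qed.

Let G_in h : 0 < h < 2 * pi -> glim h = gratio * F h.
Proof.
move=> hT; have F0 : 0 < F h by rewrite powR_gt0// chord2_gt0.
suff <- : glim h / F h = gratio by rewrite divfK// gt_eqF.
have /andP[h0 h2] := hT.
case: (ltgtP h pi) => [hp|hp|->//]; last exact: G_F_ratio (pi_gt0 _) hp h2.
by apply/esym; exact: G_F_ratio h0 hp pi_lt.
Qed.

Let F0 : F 0 = 0.
Proof. by rewrite /chord2 cos0 mulr1 subrr powR0// gt_eqF. Qed.

(** This says that the [g n] sum to g 0 / 2. It is obtained by continuity from h > 0, and it turns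
    an expansion in cos into one in 1 - cos. *)
Let G0 : glim 0 = 0.
Proof.
have [C hC] := G_lip.
have h1 : (fun n => `|glim n.+1%:R^-1|) @ \oo --> `|glim 0|.
  apply: cvg_norm; apply/subr_cvg0/cvgr0Pnorm_le => e e0; near=> n.
  apply: le_trans (hC _) _; near: n.
  have : (fun n => C * `|n.+1%:R^-1|) @ \oo --> (0 : R).
    rewrite -[X in _ --> X](mulr0 C); apply: cvgMr; rewrite -[X in _ --> X](@normr0 _ R).
    by apply: cvg_norm; exact: cvg_harmonic.
  by move=> /cvgr0_norm_le/(_ e e0); apply: filterS => n /(le_trans (ler_norm _)).
have h2 : (fun n => `|glim n.+1%:R^-1|) @ \oo --> `|gratio * F (0 : R)|.
  apply: (@cvg_trans _ ((fun n => `|gratio * F (n.+1%:R^-1 : R)|) @ \oo)).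
    apply: near_eq_cvg; apply: nearW => n; rewrite G_in// invr_gt0 ltr0n/=.
    rewrite (@le_lt_trans _ _ 1) ?invf_le1 ?ler1n// (lt_le_trans _ (_ : 4 <= _))//.
      by rewrite ltr1n.
    by have := @pi_ge2 R; lra.
  apply: cvg_norm; apply: cvgMr.
  apply: (@cvg_comp _ _ _ (fun n => n.+1%:R^-1 : R) (fun h => F h) \oo (nbhs (0 : R))).
    exact: cvg_harmonic.
  by apply: continuous_chord2_powR; exact: ltW.
have : `|glim 0| = `|gratio * F (0 : R)| by apply: (cvg_unique _ h1 h2).
by rewrite F0 mulr0 normr0 => /eqP; rewrite normr_eq0 => /eqP.
Unshelve. all: by end_near. Qed.

Let G2pi : glim (2 * pi) = glim 0.
Proof.
rewrite /glim; suff -> : psum ^~ (2 * pi) = psum ^~ 0 by [].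
apply/funext => N; rewrite /psum; congr (_ - _).
by apply: eq_bigr => i _; rewrite cos_nat2pi mulr0 cos0.
Qed.

Let G_T h : T h -> glim h = gratio * F h.
Proof.
rewrite /= in_itv/= !le_eqVlt => /andP[/predU1P[<-|h0] /predU1P[h2|h2]].
- by rewrite G0 F0 mulr0.
- by rewrite G0 F0 mulr0.
- have := @cos_nat2pi R 1; rewrite mul1r => c2.
  by rewrite h2 G2pi G0 /chord2 c2 mulr1 subrr powR0 ?mulr0// gt_eqF.
- by rewrite G_in// h0 h2.
Qed.

(** The tail of the series bounds [psum N - gratio * F] uniformly on the period, so the two
    integrals agree in the limit; both involve 2 pi [central q], which is positive. *)
Let K1 : gratio = 1.
Proof.
have cS N : continuous (psum N).
  move=> h; apply: differentiable_continuous; apply/derivable1_diffP.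
  by case: (is_derive_S N h).
have cF : continuous (fun h => F h) by apply: continuous_chord2_powR; exact: ltW.
have IS N : \int[mu]_(h in T) psum N.+1 h = 2 * pi * central q.
  elim: N => [|N IH].
    rewrite (_ : psum 1 = cst (- (g 0%N / 2))); last first.
      by apply/funext => h; rewrite /psum big_ord1/= mul0r cos0; field.
    by rewrite Rintegral_cst//= lebesgue_measure_itv/= lte_fin pi2_gt0/= subr0 gseq0; field.
  rewrite -IH; transitivity (\int[mu]_(h in T) psum N.+1 h -
      g N.+1 * \int[mu]_(h in T) cos (N.+1%:R * h)); last first.
    by rewrite Rintegral_cos_nat// mulr0 subr0.
  have cc : continuous (fun h : R => cos (N.+1%:R * h)).
    by move=> h; apply: continuous_comp; [exact: mulrl_continuous|exact: continuous_cos].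
  rewrite -RintegralZl//; last exact: continuous_integrable.
  rewrite -RintegralB//; [|exact: continuous_integrable|].
    by apply: eq_Rintegral => h _; rewrite [in LHS]/psum big_ord_recr/= opprD addrA.
  by apply: continuous_integrable => h; apply: cvgMr; exact: cc.
have diff N : `|2 * pi * central q - gratio * (2 * pi * central q)| <=
    (gabs - series (fun n => `|g n|) N.+1) * (2 * pi).
  have e : 2 * pi * central q = \int[mu]_(h in T) F h.
    rewrite central_chord_mean ?(ltW q0)// /chord_mean mulrA divff ?mul1r//.
    by rewrite gt_eqF// pi2_gt0.
  rewrite {2}e -{1}(IS N) -RintegralZl//; last exact: continuous_integrable.
  have cKF : continuous (fun h => gratio * F h) by move=> h; apply: cvgMr; exact: cF.
  have cD : continuous (fun h => psum N.+1 h - gratio * F h).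
    by move=> h; apply: cvgB; [exact: cS|exact: cKF].
  rewrite -RintegralB//; [|exact: continuous_integrable..].
  apply: le_trans (le_normr_Rintegral _ _) _ => //; first exact: continuous_integrable.
  rewrite -[X in _ <= _ * X](_ : fine (mu T) = _); last first.
    by rewrite lebesgue_measure_itv/= lte_fin pi2_gt0/= subr0.
  rewrite -Rintegral_cst//; apply: le_Rintegral => //.
  - apply: continuous_integrable => h; apply: cvg_norm; exact: cD.
  - by apply: continuous_integrable => h; exact: cvg_cst.
  - by move=> h hT; rewrite -G_T//; exact: S_G_dist.
have h0 : `|2 * pi * central q - gratio * (2 * pi * central q)| <= 0.
  apply: (@cvgr_to_ge _ \oo _ _ (fun N => (gabs - series (fun n => `|g n|) N.+1) * (2 * pi))).
    rewrite -[X in _ --> X](mul0r (2 * pi)); apply: cvgMl; rewrite -[X in _ --> X](subrr gabs).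
    apply: cvgB; first exact: cvg_cst.
    by rewrite (cvg_shiftS (series (fun n => `|g n|))); exact: cvg_normed_gseq.
  exact: nearW.
have c0 : 0 < 2 * pi * central q.
  by apply: mulr_gt0; [exact: pi2_gt0|rewrite central_gt0// ltW].
move: h0; rewrite normr_le0 -{1}[2 * pi * _]mul1r -mulrBl mulf_eq0 (gt_eqF c0) orbF.
by rewrite subr_eq0 => /eqP.
Qed.

Lemma chord2_powR_expansion h : 0 <= h <= 2 * pi ->
  (fun N => \sum_(n < N) g n * (1 - cos (n%:R * h))) @ \oo --> chord2 h `^ q.
Proof.
move=> hT.
have e : (fun N => \sum_(n < N) g n * (1 - cos (n%:R * h))) = (fun N => psum N h - psum N 0).
  by apply/funext => N; rewrite S_sub; apply: eq_bigr => i _; rewrite mulr0 cos0.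
have : (fun N => psum N h - psum N 0) @ \oo --> glim h - glim 0 by apply: cvgB; exact: S_cvg.
by rewrite e G0 subr0 G_T ?K1 ?mul1r//= in_itv.
Qed.

End power_series.

(** * Integration of bounded functions over the square *)

Section double_integral.
Context {R : realType}.
Implicit Types (f g : R * R -> R) (k : R -> R).
Notation mu := (@lebesgue_measure R).
Notation T := (`[0, 2 * pi]%classic : set R).

Definition Sq : set (R * R) := T `*` T.
Definition mu2 := (mu \x mu)%E.
Definition J f : R := \int[mu2]_(z in Sq) f z.

Lemma measurable_Sq : measurable Sq.
Proof. by apply: measurableX; exact: measurable_itv. Qed.

Lemma mu2_Sq : mu2 Sq = ((2 * pi) * (2 * pi))%:E.
Proof.
rewrite /mu2 /Sq product_measure1E; [|exact: measurable_itv..].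
by rewrite [X in (X * X)%E](_ : _ = (2 * pi)%:E) ?EFinM//; exact: mu_T.
Qed.

(** A class closed under the ring operations, integrable on [Sq], and whose sections inherit both
    properties, as Fubini requires. *)
Definition bmeas f := measurable_fun setT f /\ exists M : R, forall z, Sq z -> `|f z| <= M.

Lemma bmeas_integrable f : bmeas f -> mu2.-integrable Sq (EFin \o f).
Proof.
move=> [mf [M hM]]; apply: measurable_bounded_integrable.
- exact: measurable_Sq.
- by rewrite [X in (X < _)%E]mu2_Sq ltry.
- exact: measurable_funTS.
- by exists M; split; [exact: num_real|move=> x Mx z /hM /le_trans; apply; exact: ltW].
Qed.

Lemma bmeas_cst c : bmeas (fun=> c).
Proof. by split; [exact: measurable_cst|exists `|c|]. Qed.

Lemma bmeasD f g : bmeas f -> bmeas g -> bmeas (fun z => f z + g z).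
Proof.
move=> [mf [M hM]] [mg [N hN]]; split; first exact: measurable_funD.
by exists (M + N) => z zS; rewrite (le_trans (ler_normD _ _))// lerD ?hM ?hN.
Qed.

Lemma bmeasM f g : bmeas f -> bmeas g -> bmeas (fun z => f z * g z).
Proof.
move=> [mf [M hM]] [mg [N hN]]; split; first exact: measurable_funM.
by exists (M * N) => z zS; rewrite normrM ler_pM ?hM ?hN.
Qed.

Lemma bmeasZ c f : bmeas f -> bmeas (fun z => c * f z).
Proof. exact: bmeasM (bmeas_cst c). Qed.

Lemma bmeasN f : bmeas f -> bmeas (fun z => - f z).
Proof.
by move=> /(bmeasZ (- 1)); under [in X in X -> _]eq_fun do rewrite mulN1r.
Qed.

Lemma bmeasB f g : bmeas f -> bmeas g -> bmeas (fun z => f z - g z).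
Proof. by move=> bf /bmeasN; exact: bmeasD. Qed.

Lemma bmeas_sum n (F : nat -> R * R -> R) : (forall i, bmeas (F i)) ->
  bmeas (fun z => \sum_(i < n) F i z).
Proof.
move=> bF; elim: n => [|n IH].
  by under eq_fun do rewrite big_ord0; exact: bmeas_cst.
by under eq_fun do rewrite big_ord_recr/=; exact: bmeasD.
Qed.

Lemma continuous_bounded (a b : R) k : a <= b -> continuous k ->
  exists M : R, forall x, a <= x <= b -> `|k x| <= M.
Proof.
move=> ab ck.
have cn : continuous (fun x => `|k x|) by move=> x; apply: cvg_norm; exact: ck.
have [c _ hc] := @EVT_max R (fun x => `|k x|) a b ab (continuous_subspaceT cn).
by exists `|k c| => x xab; apply: hc; rewrite in_itv.
Qed.

Lemma bmeas_fst k : continuous k -> bmeas (fun z => k z.1).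
Proof.
move=> ck; split.
  by apply: measurableT_comp; [exact: continuous_measurable_fun|exact: measurable_fst].
have [M hM] := continuous_bounded (ltW (@pi2_gt0 R)) ck.
by exists M => -[x y] [/= xT _]; apply: hM; rewrite in_itv/= in xT.
Qed.

Lemma bmeas_snd k : continuous k -> bmeas (fun z => k z.2).
Proof.
move=> ck; split.
  by apply: measurableT_comp; [exact: continuous_measurable_fun|exact: measurable_snd].
have [M hM] := continuous_bounded (ltW (@pi2_gt0 R)) ck.
by exists M => -[x y] [/= _ yT]; apply: hM; rewrite in_itv/= in yT.
Qed.

Lemma bmeas_sub k : continuous k -> bmeas (fun z => k (z.1 - z.2)).
Proof.
move=> ck; split.
  apply: measurableT_comp; first exact: continuous_measurable_fun.
  by apply: measurable_funB; [exact: measurable_fst|exact: measurable_snd].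
have [|M hM] := @continuous_bounded (- (2 * pi)) (2 * pi) k _ ck.
  by have := @pi2_gt0 R; lra.
exists M => -[x y] [/=]; rewrite !in_itv/= => /andP[x0 x1] /andP[y0 y1].
by apply: hM; apply/andP; split; lra.
Qed.

Lemma J_D f g : bmeas f -> bmeas g -> J (fun z => f z + g z) = J f + J g.
Proof.
by move=> bf bg; rewrite /J RintegralD//; [exact: measurable_Sq|exact: bmeas_integrable..].
Qed.

Lemma J_Z c f : bmeas f -> J (fun z => c * f z) = c * J f.
Proof.
by move=> bf; rewrite /J RintegralZl//; [exact: measurable_Sq|exact: bmeas_integrable].
Qed.

Lemma J_N f : bmeas f -> J (fun z => - f z) = - J f.
Proof.
move=> bf; rewrite -mulN1r -J_Z//; congr J.
by apply/funext => z; rewrite mulN1r.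
Qed.

Lemma J_B f g : bmeas f -> bmeas g -> J (fun z => f z - g z) = J f - J g.
Proof. by move=> bf bg; rewrite J_D ?J_N//; exact: bmeasN. Qed.

Lemma J_sum n (F : nat -> R * R -> R) : (forall i, bmeas (F i)) ->
  J (fun z => \sum_(i < n) F i z) = \sum_(i < n) J (F i).
Proof.
move=> bF; elim: n => [|n IH].
  under eq_fun do rewrite big_ord0.
  by rewrite big_ord0 /J Rintegral_cst ?mul0r//; exact: measurable_Sq.
under eq_fun do rewrite big_ord_recr/=.
by rewrite J_D ?IH ?big_ord_recr//; exact: bmeas_sum.
Qed.

Lemma eq_J f g : (forall z, Sq z -> f z = g z) -> J f = J g.
Proof. by move=> fg; apply: eq_Rintegral => z; rewrite inE; exact: fg. Qed.

Lemma le_J f g : bmeas f -> bmeas g -> (forall z, Sq z -> f z <= g z) -> J f <= J g.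
Proof.
move=> bf bg fg; apply: le_Rintegral => //; first exact: measurable_Sq.
- exact: bmeas_integrable.
- exact: bmeas_integrable.
Qed.

Lemma J_cst c : J (fun=> c) = c * ((2 * pi) * (2 * pi)).
Proof.
rewrite /J Rintegral_cst; last exact: measurable_Sq.
by rewrite [X in fine X]mu2_Sq.
Qed.

Lemma J_ge0 f : (forall z, Sq z -> 0 <= f z) -> 0 <= J f.
Proof. by move=> h; apply: Rintegral_ge0. Qed.

Lemma norm_J_le f M : bmeas f -> (forall z, Sq z -> `|f z| <= M) ->
  `|J f| <= M * ((2 * pi) * (2 * pi)).
Proof.
move=> bf hM; have bM := bmeas_cst M.
rewrite -J_cst ler_norml -J_N//; apply/andP; split; apply: le_J => //.
- exact: bmeasN.
- by move=> z /hM; rewrite ler_norml => /andP[].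
- by move=> z /hM; rewrite ler_norml => /andP[].
Qed.

Lemma EFin_J f : bmeas f -> (J f)%:E = (\int[mu2]_(z in Sq) (f z)%:E)%E.
Proof.
move=> bf; rewrite /J /Rintegral fineK//.
by apply: integrable_fin_num; [exact: measurable_Sq|exact: bmeas_integrable].
Qed.

Let section_bounded f (x : R) : bmeas f -> T x ->
  mu.-integrable T (EFin \o (fun y => f (x, y))).
Proof.
move=> [mf [M hM]] xT; apply: measurable_bounded_integrable.
- exact: measurable_itv.
- by rewrite [X in (X < _)%E]mu_T ltry.
- by apply: measurable_funTS; apply: measurableT_comp.
- by exists M; split; [exact: num_real|move=> y My z zT; apply: le_trans (ltW My); exact: hM].
Qed.

Let section_bounded2 f (y : R) : bmeas f -> T y ->
  mu.-integrable T (EFin \o (fun x => f (x, y))).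
Proof.
move=> [mf [M hM]] xT; apply: measurable_bounded_integrable.
- exact: measurable_itv.
- by rewrite [X in (X < _)%E]mu_T ltry.
- by apply: measurable_funTS; apply: measurableT_comp.
- by exists M; split; [exact: num_real|move=> x My z zT; apply: le_trans (ltW My); exact: hM].
Qed.

Lemma integral_Sq (f : R * R -> \bar R) : measurable_fun setT f -> (forall z, 0 <= f z)%E ->
  (\int[mu2]_(z in Sq) f z = \int[mu]_(x in T) \int[mu]_(y in T) f (x, y))%E.
Proof.
move=> mf f0; rewrite integral_mkcond fubini_tonelli1; last 2 first.
- apply/(measurable_restrictT _ _).1 => //; first exact: measurable_Sq.
  exact: measurable_funTS.
- by move=> z; rewrite patchE; case: ifP.
rewrite [RHS]integral_mkcond; apply: eq_integral => x _.
rewrite patchE /fubini_F; case: ifPn => xT.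
  rewrite [RHS]integral_mkcond; apply: eq_integral => y _.
  by rewrite !patchE in_setX xT.
by apply: integral0_eq => y _; rewrite patchE in_setX (negPf xT).
Qed.

Lemma J_iter1 f : bmeas f -> J f = \int[mu]_(x in T) \int[mu]_(y in T) f (x, y).
Proof.
move=> bf; rewrite /J /Rintegral; congr fine.
have fi := (@integrable_mkcond _ _ R mu2 Sq (EFin \o f) measurable_Sq).1 (bmeas_integrable bf).
rewrite integral_mkcond -(integral12_prod_meas1 fi).
rewrite [RHS]integral_mkcond; apply: eq_integral => x _.
rewrite patchE /fubini_F; case: ifPn => xT.
  rewrite fineK; last first.
    by apply: integrable_fin_num; [exact: measurable_itv|apply: section_bounded => //; exact/set_mem].
  rewrite [RHS]integral_mkcond; apply: eq_integral => y _.
  by rewrite !patchE in_setX xT.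
by apply: integral0_eq => y _; rewrite patchE in_setX (negPf xT).
Qed.

Lemma J_iter2 f : bmeas f -> J f = \int[mu]_(y in T) \int[mu]_(x in T) f (x, y).
Proof.
move=> bf; rewrite /J /Rintegral; congr fine.
have fi := (@integrable_mkcond _ _ R mu2 Sq (EFin \o f) measurable_Sq).1 (bmeas_integrable bf).
rewrite integral_mkcond -(integral21_prod_meas1 fi).
rewrite [RHS]integral_mkcond; apply: eq_integral => y _.
rewrite patchE /fubini_G; case: ifPn => yT.
  rewrite fineK; last first.
    by apply: integrable_fin_num; [exact: measurable_itv|apply: section_bounded2 => //; exact/set_mem].
  rewrite [RHS]integral_mkcond; apply: eq_integral => x _.
  by rewrite !patchE in_setX yT andbT.
by apply: integral0_eq => x _; rewrite patchE in_setX (negPf yT) andbF.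
Qed.

Lemma J_prod k1 k2 : continuous k1 -> continuous k2 ->
  J (fun z => k1 z.1 * k2 z.2) = \int[mu]_(x in T) k1 x * \int[mu]_(x in T) k2 x.
Proof.
move=> c1 c2; rewrite J_iter1; last by apply: bmeasM; [exact: bmeas_fst|exact: bmeas_snd].
rewrite -RintegralZr//; [|exact: continuous_integrable].
by apply: eq_Rintegral => x _ /=; rewrite RintegralZl//; exact: continuous_integrable.
Qed.

Lemma J_cvg (F : nat -> R * R -> R) f M : (forall n, bmeas (F n)) -> bmeas f ->
  (forall n z, Sq z -> `|F n z| <= M) ->
  (forall z, Sq z -> F ^~ z @ \oo --> f z) -> (fun n => J (F n)) @ \oo --> J f.
Proof.
move=> bF bf hM cF.
have [] := @dominated_convergence _ _ _ mu2 Sq measurable_Sq (fun n z => (F n z)%:E)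
  (fun z => (f z)%:E) (fun=> M%:E).
- by move=> n; apply/measurable_EFinP/measurable_funTS; case: (bF n).
- by apply/measurable_EFinP/measurable_funTS; case: bf.
- by apply: aeW => z zS; apply: cvg_EFin; [exact: nearW|exact: cF].
- exact: bmeas_integrable (bmeas_cst M).
- by apply: aeW => z n zS; rewrite lee_fin; exact: hM.
move=> _ _ /= h; rewrite -EFin_J// in h.
by move/fine_cvgP: h => -[_].
Qed.

End double_integral.

(** * Poisson and conjugate kernels *)

Section abel_kernels.
Context {R : realType}.
Implicit Types (r h D : R) (N : nat).

(** The squared modulus of 1 - r e^{ih}. [Pker] is the Poisson kernel, [sker] the sum of r^j sin (j
    h), and [dsker] the derivative of [sker] in h, which becomes -1 / chord2 at r = 1. *)
Definition Qker r h : R := 1 - 2 * r * cos h + r ^+ 2.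
Definition Pker r h : R := (1 - r ^+ 2) / Qker r h.
Definition sker r h : R := r * sin h / Qker r h.
Definition dsker r h : R := r * ((1 + r ^+ 2) * cos h - 2 * r) / Qker r h ^+ 2.

Lemma QkerE r h : Qker r h = (1 - r) ^+ 2 + r * chord2 h.
Proof. by rewrite /Qker /chord2; ring. Qed.

Lemma Qker_ge r h : 0 <= r -> (1 - r) ^+ 2 <= Qker r h.
Proof. by move=> r0; rewrite QkerE lerDl mulr_ge0// chord2_ge0. Qed.

Lemma Qker_gt0 r h : 0 <= r < 1 -> 0 < Qker r h.
Proof.
move=> /andP[r0 r1]; apply: lt_le_trans (Qker_ge h r0).
by rewrite exprn_gt0// subr_gt0.
Qed.

Lemma continuous_Qker r : continuous (Qker r).
Proof.
move=> h; apply: differentiable_continuous; apply/derivable1_diffP.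
have dQ : is_derive h 1 (Qker r) (2 * r * sin h).
  by apply: is_derive_eq; rewrite /GRing.scale/=; ring.
by case: dQ.
Qed.

Lemma continuous_invQ r (k : R -> R) : 0 <= r < 1 -> continuous k ->
  continuous (fun h => k h / Qker r h).
Proof.
move=> r01 ck h; apply: cvgM; first exact: ck.
apply: cvgV; first by rewrite gt_eqF// Qker_gt0.
exact: continuous_Qker.
Qed.

Lemma continuous_Pker r : 0 <= r < 1 -> continuous (Pker r).
Proof. by move=> r01; apply: continuous_invQ => // h; exact: cvg_cst. Qed.

Lemma continuous_sker r : 0 <= r < 1 -> continuous (sker r).
Proof.
move=> r01; apply: continuous_invQ => // h.
by apply: cvgMr; exact: continuous_sin.
Qed.

Lemma continuous_dsker r : 0 <= r < 1 -> continuous (dsker r).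
Proof.
move=> r01.
rewrite (_ : dsker r = (fun h => r * ((1 + r ^+ 2) * cos h - 2 * r) / Qker r h / Qker r h)).
  apply: continuous_invQ => //; apply: continuous_invQ => // h.
  apply: cvgMr; apply: cvgB; last exact: cvg_cst.
  by apply: cvgMr; exact: continuous_cos.
by apply/funext => h; rewrite /dsker expr2 invfM mulrA.
Qed.

Lemma is_derive_sker r h : 0 <= r < 1 -> is_derive h 1 (sker r) (dsker r h).
Proof.
move=> r01; have Q0 := Qker_gt0 h r01.
have dQ : is_derive h 1 (Qker r) (2 * r * sin h).
  by apply: is_derive_eq; rewrite /GRing.scale/=; ring.
have dQV : is_derive h 1 (fun x => (Qker r x)^-1) (- (Qker r h ^- 2) *: (2 * r * sin h)).
  by apply: is_deriveV => //; rewrite gt_eqF.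
apply: is_derive_eq; rewrite /GRing.scale/= /dsker.
have s2 := cos2Dsin2 h.
have -> : r * sin h * (- Qker r h ^- 2 * (2 * r * sin h)) =
    - (2 * r ^+ 2 * (sin h ^+ 2) * Qker r h ^- 2) by ring.
rewrite sin2cos2; have Qn : Qker r h != 0 by rewrite gt_eqF.
apply: (mulIf (expf_neq0 2 Qn)); rewrite divfK ?expf_neq0// mulrDl mulNr divfK ?expf_neq0//.
rewrite (_ : (Qker r h)^-1 * (r * cos h) * Qker r h ^+ 2 = r * cos h * Qker r h); last by field.
by rewrite /Qker; ring.
Qed.

(** Real part of the finite geometric sum of e^{iD} (r e^{ih})^j, with the denominator cleared
    through the conjugate 1 - r e^{-ih}. *)
Lemma abel_cos_sum r h D N : Qker r h * \sum_(j < N) r ^+ j * cos (D + j%:R * h) =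
  cos D - r * cos (D - h) -
  (r ^+ N * cos (D + N%:R * h) - r ^+ N.+1 * cos (D + N%:R * h - h)).
Proof.
elim: N => [|N IH]; first by rewrite big_ord0 mulr0 mul0r addr0 expr1 expr0 mul1r subrr.
rewrite big_ord_recr/= mulrDr IH.
rewrite (_ : D + N.+1%:R * h - h = D + N%:R * h); last by rewrite -natr1; ring.
rewrite (_ : D + N.+1%:R * h = D + N%:R * h + h); last by rewrite -natr1; ring.
move: (D + N%:R * h) => x; rewrite [cos (x + h)]cosD [cos (x - h)]cosB /Qker !exprS; ring.
Qed.

(** Separates the part of the kernel even in h from the odd one; [(1 + Pker r h) / 2] is the sum of
    r^j cos (j h) from j = 0. *)
Lemma abel_kernelE r h D : 0 <= r < 1 -> (cos D - r * cos (D - h)) / Qker r h =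
  cos D * ((1 + Pker r h) / 2) - sin D * sker r h.
Proof.
move=> r01; have Q0 := Qker_gt0 h r01.
rewrite cosB /sker /Pker.
apply: (mulIf (lt0r_neq0 Q0)); rewrite divfK ?gt_eqF//.
transitivity (cos D * ((Qker r h + (1 - r ^+ 2)) / 2) - sin D * (r * sin h)); last first.
  by field; rewrite gt_eqF.
by rewrite /Qker; field.
Qed.

Lemma abel_remainder r h D N : 0 <= r < 1 ->
  `|\sum_(j < N) r ^+ j * cos (D + j%:R * h) - (cos D - r * cos (D - h)) / Qker r h|
  <= 2 * r ^+ N / (1 - r) ^+ 2.
Proof.
move=> r01; have Q0 := Qker_gt0 h r01; have /andP[r0 r1] := r01.
have -> : \sum_(j < N) r ^+ j * cos (D + j%:R * h) - (cos D - r * cos (D - h)) / Qker r h =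
  - ((r ^+ N * cos (D + N%:R * h) - r ^+ N.+1 * cos (D + N%:R * h - h)) / Qker r h).
  apply: (mulfI (lt0r_neq0 Q0)); rewrite mulrBr abel_cos_sum.
  by field; rewrite gt_eqF.
rewrite normrN normrM [`|_^-1|]gtr0_norm ?invr_gt0//.
rewrite ler_pM ?invr_ge0 ?(ltW Q0)//; last first.
  by rewrite lef_pV2 ?posrE ?Qker_ge// exprn_gt0// subr_gt0.
rewrite (le_trans (ler_normB _ _))// (_ : 2 * r ^+ N = r ^+ N + r ^+ N); last by ring.
rewrite lerD//.
  by rewrite normrM normrX (ger0_norm r0) ler_piMr ?exprn_ge0 ?cos_max.
rewrite normrM normrX (ger0_norm r0) exprS -mulrA.
rewrite (@le_trans _ _ (r * r ^+ N))//.
  by rewrite ler_wpM2l// ler_piMr ?exprn_ge0 ?cos_max.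
by rewrite ler_piMl ?exprn_ge0// ltW.
Qed.

Lemma Pker_ge0 r h : 0 <= r < 1 -> 0 <= Pker r h.
Proof.
move=> r01; have /andP[r0 r1] := r01; rewrite divr_ge0 ?(ltW (Qker_gt0 h r01))//.
by rewrite subr_ge0 expr_le1// ltW.
Qed.

(** Since r chord2 <= Qker, the factor [chord2] cancels the peak of the Poisson kernel and leaves a
    uniform bound that tends to 0 as r -> 1. *)
Lemma Pker_chord2 r h : 0 < r < 1 -> chord2 h * Pker r h <= (1 - r ^+ 2) / r.
Proof.
move=> /andP[r0 r1]; have r01 : 0 <= r < 1 by rewrite (ltW r0).
have Q0 := Qker_gt0 h r01.
have r2 : 0 <= 1 - r ^+ 2 by rewrite subr_ge0 expr_le1// ltW.
rewrite /Pker mulrCA ler_wpM2l// ler_pdivrMr// mulrC ler_pdivlMr// QkerE mulrC.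
by rewrite lerDr sqr_ge0.
Qed.

(** Uniform in r, hence a domination for r -> 1. With c = cos h, adding (1 + r^2) c - 2r to [Qker]
    gives (1 - r)^2 (1 + c), subtracting it gives (1 + r)^2 (1 - c); both are nonnegative. *)
Lemma dsker_chord2 r h : 0 < r < 1 -> `|dsker r h| * chord2 h <= 1.
Proof.
move=> /andP[r0 r1]; have r01 : 0 <= r < 1 by rewrite (ltW r0).
have Q0 := Qker_gt0 h r01; have S0 := chord2_ge0 h.
have bnd : `|(1 + r ^+ 2) * cos h - 2 * r| <= Qker r h.
  have c1 := cos_le1 h; have c2 := cos_geN1 h.
  have h1 : 0 <= (1 - r) ^+ 2 * (1 + cos h) by rewrite mulr_ge0 ?sqr_ge0//; lra.
  have h2 : 0 <= (1 + r) ^+ 2 * (1 - cos h) by rewrite mulr_ge0 ?sqr_ge0//; lra.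
  rewrite ler_norml /Qker; apply/andP; split; rewrite -subr_ge0.
    by apply: le_trans h1 _; rewrite le_eqVlt; apply/orP; left; apply/eqP; ring.
  by apply: le_trans h2 _; rewrite le_eqVlt; apply/orP; left; apply/eqP; ring.
rewrite /dsker normrM normrM (gtr0_norm r0) [`|_^-1|]gtr0_norm ?invr_gt0 ?exprn_gt0//.
rewrite mulrAC ler_pdivrMr ?exprn_gt0// mul1r [leRHS]expr2 [r * _]mulrC -[leLHS]mulrA.
rewrite ler_pM ?mulr_ge0 ?(ltW r0)//.
by rewrite QkerE lerDr sqr_ge0.
Qed.

Lemma dsker_cvg h (r_ : nat -> R) : 0 < chord2 h -> r_ @ \oo --> (1 : R) ->
  (fun n => - dsker (r_ n) h) @ \oo --> (chord2 h)^-1.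
Proof.
move=> S0 r1.
have Q1 : Qker 1 h = chord2 h by rewrite QkerE subrr expr0n add0r mul1r.
have -> : (chord2 h)^-1 = - (1 * ((1 + 1 ^+ 2) * cos h - 2 * 1) / Qker 1 h ^+ 2).
  by rewrite Q1 /chord2; field; move: S0; rewrite /chord2 => /lt0r_neq0.
have r2 : (fun n => r_ n ^+ 2) @ \oo --> (1 ^+ 2 : R) by apply: cvgM.
apply: cvgN; apply: cvgM.
  apply: cvgM => //; apply: cvgB; last exact: cvgMr.
  by apply: cvgMl; apply: cvgD => //; exact: cvg_cst.
have cQ : (fun n => Qker (r_ n) h) @ \oo --> Qker 1 h.
  rewrite /Qker; apply: cvgD => //; apply: cvgB; first exact: cvg_cst.
  by apply: cvgMl; exact: cvgMr.
apply: cvgV; first by rewrite Q1 expf_neq0// gt_eqF.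
by apply: cvgM.
Qed.

End abel_kernels.

(** * Comparison of chord and arc *)

Section chord_arc.
Context {R : realType}.

Lemma sin_le_norm (x : R) : `|sin x| <= `|x|.
Proof.
wlog x0 : x / 0 <= x.
  by move=> H; case: (leP 0 x) => [/H//|x0]; rewrite -normrN -sinN -[leRHS]normrN H// oppr_ge0 ltW.
have [|c _] := @MVT_segment R sin cos 0 x x0.
  exact/continuous_subspaceT/continuous_sin.
rewrite sin0 !subr0 => ->.
by rewrite normrM ler_piMl// cos_max.
Qed.

Lemma one_sub_cos_le (x : R) : 1 - cos x <= x ^+ 2 / 2.
Proof.
have {1}-> : x = (x / 2) *+ 2 by rewrite -mulr_natr divfK.
rewrite cos_mulr2n cos2sin2.
have h : sin (x / 2) ^+ 2 <= (x / 2) ^+ 2.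
  by rewrite -[leLHS]real_normK ?num_real// -[leRHS]real_normK ?num_real// ler_pXn2r ?nnegrE// sin_le_norm.
apply: (@le_trans _ _ (2 * sin (x / 2) ^+ 2)).
  by rewrite -mulr_natl; lra.
have -> : x ^+ 2 / 2 = 2 * (x / 2) ^+ 2 by field.
by rewrite ler_pM2l.
Qed.

(** A crude Jordan inequality: on [0, 1] the slope of sin is at least cos 1; beyond 1, sin t >= sin
    1 >= cos 1 and t < 2 suffice. *)
Lemma sin_ge_lin (t : R) : 0 <= t <= pi / 2 -> cos 1 / 2 * t <= sin t.
Proof.
move=> /andP[t0 t2]; have c1 := @cos1_gt0 R; have p2 := @pi_ge2 R.
have p21 := @pihalf_lt2 R; have p1 := @pihalf_ge1 R.
have lin1 (x : R) : 0 <= x <= 1 -> cos 1 * x <= sin x.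
  move=> /andP[x0 x1].
  have [|c] := @MVT_segment R sin cos 0 x x0.
    exact/continuous_subspaceT/continuous_sin.
  rewrite in_itv/= sin0 !subr0 => /andP[c0 cx] ->.
  rewrite ler_wpM2r// leNgt ltr_cos; last 2 first.
  - by rewrite in_itv/=; lra.
  - by rewrite in_itv/=; lra.
  by rewrite -leNgt; lra.
have [t1|t1] := leP t 1.
  apply: le_trans (lin1 t _); last by rewrite t0 t1.
  by rewrite ler_wpM2r//; lra.
apply: (@le_trans _ _ (cos 1)); first by nra.
have := lin1 1; rewrite mulr1 ler01 lexx => /(_ isT) /le_trans; apply.
rewrite leNgt ltr_sin; last 2 first.
- by rewrite in_itv/=; lra.
- by rewrite in_itv/=; lra.
by rewrite -leNgt ltW.
Qed.

Lemma chord2_ge_arc (h : R) : `|h| <= pi -> (cos 1 / 2 * h) ^+ 2 <= chord2 h.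
Proof.
move=> hp; have c1 := @cos1_gt0 R.
have -> : chord2 h = 4 * sin (`|h| / 2) ^+ 2.
  rewrite /chord2 -cos_norm {1}(_ : `|h| = (`|h| / 2) *+ 2); last by rewrite -mulr_natr divfK.
  by rewrite cos_mulr2n sin2cos2; ring.
have h0 : 0 <= `|h| / 2 <= pi / 2 by rewrite divr_ge0//= ler_pM2r.
have := sin_ge_lin h0; set t := `|h| / 2 => st.
have -> : (cos 1 / 2 * h) ^+ 2 = 4 * (cos 1 / 2 * t) ^+ 2.
  by rewrite /t !exprMn -[h ^+ 2]real_normK ?num_real//; field.
have /andP[t0 _] := h0.
rewrite ler_pM2l// ler_pXn2r ?nnegrE//.
  by rewrite mulr_ge0// divr_ge0// ltW.
by apply: le_trans st; rewrite mulr_ge0// divr_ge0// ltW.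
Qed.

Lemma cos_shift (x : R) (n : nat) : cos (x + 2 * pi * n%:R) = cos x.
Proof. by have := periodicn (@cosD2pi R) n x; rewrite mulr_natl mulr_natr. Qed.

Lemma sin_shift (x : R) (n : nat) : sin (x + 2 * pi * n%:R) = sin x.
Proof. by have := periodicn (@sinD2pi R) n x; rewrite mulr_natl mulr_natr. Qed.

End chord_arc.

(** * Douglas' formula *)

Section douglas.
Context {R : realType}.
Implicit Types (x y t h r : R) (n m j N : nat) (z : R * R).
Notation mu := (@lebesgue_measure R).
Notation T := (`[0, 2 * pi]%classic : set R).
Variables (phi w : R -> R) (d : nat).
Hypothesis dphi : forall t, is_derive t 1 phi (w t).
Hypothesis cw : continuous w.
Hypothesis phi_per : forall t, phi (t + 2 * pi) = phi t + 2 * pi * d%:R.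

Let continuous_phi : continuous phi.
Proof.
move=> t; apply: differentiable_continuous; apply/derivable1_diffP.
by case: (dphi t).
Qed.

Definition Dl n z : R := n%:R * (phi z.1 - phi z.2).

(** Lipschitz bound for [phi] against the chord-arc inequality, which needs |x - y| <= pi. Otherwise
    the smaller argument is moved up one period, which changes neither the cosine nor the chord;
    hence the bound for [w] on [0, 4 pi]. *)
Lemma phi_arc_bound : exists C : R, 0 <= C /\ forall n x y, T x -> T y ->
  1 - cos (Dl n (x, y)) <= C * n%:R ^+ 2 * chord2 (x - y).
Proof.
have p0 := @pi_gt0 R.
have [|M hM] := @continuous_bounded R 0 (4 * pi) w _ cw; first by lra.
have lip x y : 0 <= x <= 4 * pi -> 0 <= y <= 4 * pi -> `|phi x - phi y| <= M * `|x - y|.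
  wlog xy : x y / y <= x.
    move=> H xI yI; case: (leP y x) => [/H|/ltW/H]; first exact.
    by rewrite distrC [`|x - y|]distrC; apply.
  move=> /andP[x0 x1] /andP[y0 y1].
  have [|c] := @MVT_segment R phi w y x xy.
    exact/continuous_subspaceT/continuous_phi.
  rewrite in_itv/= => /andP[yc cx] ->; rewrite normrM ler_wpM2r// hM//.
  by rewrite (le_trans y0)//= (le_trans cx).
have c1 : 0 < cos (1 : R) / 2 by rewrite divr_gt0// cos1_gt0.
have := @chord2_ge_arc R; move: (cos (1 : R) / 2) c1 => c c1 arc.
pose C := M ^+ 2 / (2 * c ^+ 2).
have c2 : 0 < 2 * c ^+ 2 by rewrite mulr_gt0 ?exprn_gt0.
have C0 : 0 <= C by rewrite /C divr_ge0 ?sqr_ge0 ?(ltW c2).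
have near_bound n x y : 0 <= x <= 4 * pi -> 0 <= y <= 4 * pi -> `|x - y| <= pi ->
    1 - cos (Dl n (x, y)) <= C * n%:R ^+ 2 * chord2 (x - y).
  move=> xI yI xy; apply: le_trans (one_sub_cos_le _) _.
  have h1 : (phi x - phi y) ^+ 2 <= (M * `|x - y|) ^+ 2.
    rewrite -[leLHS]real_normK ?num_real// ler_pXn2r ?nnegrE// ?lip//.
    by apply: le_trans (lip _ _ xI yI).
  have h2 := arc _ xy.
  rewrite /Dl/= exprMn (_ : C * _ * _ = n%:R ^+ 2 * (C * chord2 (x - y))); last by ring.
  rewrite -mulrA ler_wpM2l ?sqr_ge0//.
  apply: (@le_trans _ _ (C * (c * (x - y)) ^+ 2)); last by rewrite ler_wpM2l.
  rewrite ler_pdivrMr//; apply: le_trans h1 _.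
  rewrite exprMn real_normK ?num_real// /C le_eqVlt; apply/orP; left; apply/eqP.
  by field; rewrite gt_eqF.
exists C; split=> // n x y; rewrite /= !in_itv/= => /andP[x0 x1] /andP[y0 y1].
have chord_shift h : chord2 (h + 2 * pi) = chord2 h.
  by have := cos_shift h 1; rewrite mulr1 /chord2 => ->.
case: (leP `|x - y| pi) => xy; first by apply: near_bound => //; apply/andP; split; lra.
case: (leP y x) => yx.
- have := @near_bound n x (y + 2 * pi); rewrite ger0_norm ?subr_ge0// in xy.
  have -> : Dl n (x, y + 2 * pi) = Dl n (x, y) - 2 * pi * (n * d)%:R.
    by rewrite /Dl/= phi_per natrM; ring.
  rewrite -[cos (_ - _)](cos_shift _ (n * d)) subrK.
  rewrite -[chord2 (x - (y + 2 * pi))]chord_shift.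
  rewrite (_ : x - (y + 2 * pi) + 2 * pi = x - y); last by ring.
  by apply; rewrite ?ler_norml; apply/andP; split; lra.
- have := @near_bound n (x + 2 * pi) y; rewrite ltr0_norm ?subr_lt0// in xy.
  have -> : Dl n (x + 2 * pi, y) = Dl n (x, y) + 2 * pi * (n * d)%:R.
    by rewrite /Dl/= phi_per natrM; ring.
  rewrite cos_shift (_ : x + 2 * pi - y = x - y + 2 * pi); last by ring.
  rewrite chord_shift.
  by apply; rewrite ?ler_norml; apply/andP; split; lra.
Qed.

Lemma measurable_Dl n : measurable_fun setT (Dl n).
Proof.
apply: measurable_funM; first exact: measurable_cst.
by apply: measurable_funB; (apply: measurableT_comp;
  [exact: continuous_measurable_fun|]); [exact: measurable_fst|exact: measurable_snd].
Qed.

Lemma bmeas_cos_comp (f : R * R -> R) : measurable_fun setT f -> bmeas (fun z => cos (f z)).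
Proof.
move=> mf; split; last by exists 1 => z _; exact: cos_max.
apply: (@measurableT_comp _ _ _ _ _ _ (@cos R)) => //.
by apply: continuous_measurable_fun; exact: continuous_cos.
Qed.

Lemma bmeas_sin_comp (f : R * R -> R) : measurable_fun setT f -> bmeas (fun z => sin (f z)).
Proof.
move=> mf; split; last by exists 1 => z _; exact: sin_max.
apply: (@measurableT_comp _ _ _ _ _ _ (@sin R)) => //.
by apply: continuous_measurable_fun; exact: continuous_sin.
Qed.

Lemma bmeas_cosD n : bmeas (fun z => cos (Dl n z)).
Proof. by apply: bmeas_cos_comp; exact: measurable_Dl. Qed.

Lemma bmeas_sinD n : bmeas (fun z => sin (Dl n z)).
Proof. by apply: bmeas_sin_comp; exact: measurable_Dl. Qed.

Lemma bmeas_1cosD n : bmeas (fun z => 1 - cos (Dl n z)).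
Proof. by apply: bmeasB; [exact: bmeas_cst|exact: bmeas_cosD]. Qed.

(** Where [chord2] is 0, on the diagonal and at two corners of the square, division gives 0. By
    [phi_arc_bound] the numerator vanishes there too, so [en] times [chord2] is the numerator on all
    of [Sq]. *)
Definition en n z : R := (1 - cos (Dl n z)) / chord2 (z.1 - z.2).

Lemma en_ge0 n z : 0 <= en n z.
Proof. by rewrite divr_ge0 ?chord2_ge0// subr_ge0 cos_le1. Qed.

Lemma measurable_inv_chord2 : measurable_fun setT (fun z => (chord2 (z.1 - z.2))^-1).
Proof.
rewrite (_ : (fun z => _) = (fun z => chord2 (z.1 - z.2) `^ (- 1))); last first.
  by apply/funext => z; rewrite powR_inv1 ?chord2_ge0.
apply: (@measurableT_comp _ _ _ _ _ _ (fun s : R => s `^ (- 1))).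
  exact: measurable_powR.
apply: (@measurableT_comp _ _ _ _ _ _ (@chord2 R)).
  by apply: continuous_measurable_fun; exact: continuous_chord2.
by apply: measurable_funB; [exact: measurable_fst|exact: measurable_snd].
Qed.

Lemma en_bound : exists C : R, 0 <= C /\ forall n z, Sq z -> en n z <= C * n%:R ^+ 2.
Proof.
have [C [C0 hC]] := phi_arc_bound; exists C; split=> // n [x y] [/= xT yT].
rewrite /en; have := chord2_ge0 (x - y); rewrite le_eqVlt => /predU1P[<-|S0].
  by rewrite invr0 mulr0 mulr_ge0// sqr_ge0.
by rewrite ler_pdivrMr//; exact: hC.
Qed.

Lemma bmeas_en n : bmeas (en n).
Proof.
split.
  apply: measurable_funM; last exact: measurable_inv_chord2.
  by have [] := bmeas_1cosD n.
have [C [_ hC]] := en_bound; exists (C * n%:R ^+ 2) => z zS.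
by rewrite ger0_norm ?en_ge0 ?hC.
Qed.

Definition An n : R := J (en n).

Lemma An_ge0 n : 0 <= An n.
Proof. by apply: J_ge0 => z _; exact: en_ge0. Qed.

Let remainder_cvg0 r (c : R) : 0 <= r < 1 ->
  (fun N => 2 * r ^+ N / (1 - r) ^+ 2 * c) @ \oo --> (0 : R).
Proof.
move=> /andP[r0 r1].
have h : (fun N => 2 / (1 - r) ^+ 2 * c * r ^+ N) @ \oo --> 2 / (1 - r) ^+ 2 * c * 0.
  by apply: cvgMr; apply: cvg_expr; rewrite ger0_norm.
rewrite mulr0 in h; apply: cvg_trans h; apply: near_eq_cvg; apply: nearW => N.
by ring.
Qed.

Let norm_le_remainder_eq0 r (a c : R) : 0 <= r < 1 ->
  (forall N, `|a| <= 2 * r ^+ N.+1 / (1 - r) ^+ 2 * c) -> a = 0.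
Proof.
move=> r01 h; apply/eqP; rewrite -normr_le0.
apply: (@cvgr_to_ge _ \oo _ _ (fun N => 2 * r ^+ N.+1 / (1 - r) ^+ 2 * c)); last exact: nearW.
by rewrite (cvg_shiftS (fun N => 2 * r ^+ N / (1 - r) ^+ 2 * c)); exact: remainder_cvg0.
Qed.

Lemma continuous_cos_affine (c : R) x : continuous (fun y => cos (c * (x - y))).
Proof.
move=> y; apply: continuous_comp; last exact: continuous_cos.
by apply: cvgMr; apply: cvgB; [exact: cvg_cst|exact: cvg_id].
Qed.

Lemma Rintegral_cos_conv x j : (0 < j)%N -> \int[mu]_(y in T) cos (j%:R * (x - y)) = 0.
Proof.
move=> j0; have j0' : j%:R != 0 :> R by rewrite pnatr_eq0 -lt0n.
have c1 := @continuous_cos_affine j%:R x.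
have c2 : continuous (fun y => - sin (j%:R * (x - y)) / j%:R).
  move=> y; apply: cvgMl; apply: cvgN; apply: continuous_comp; last exact: continuous_sin.
  by apply: cvgMr; apply: cvgB; [exact: cvg_cst|exact: cvg_id].
have dF y : 0 < y < 2 * pi ->
    is_derive y 1 (fun y => - sin (j%:R * (x - y)) / j%:R) (cos (j%:R * (x - y))).
  by move=> _; apply: is_derive_eq; rewrite /GRing.scale/=; field.
rewrite (Rintegral_derive pi2_gt0 (continuous_subspaceT c1) (continuous_subspaceT c2) dF).
rewrite subr0 -[sin (_ * (x - _))](sin_shift _ j).
by rewrite (_ : _ * (x - _) + _ = j%:R * x) ?subrr//; ring.
Qed.

Let continuous_subl (k : R -> R) x : continuous k -> continuous (fun y => k (x - y)).
Proof.
move=> ck y; apply: (@continuous_comp _ _ _ (fun y => x - y) k); last exact: ck.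
by apply: cvgB; [exact: cvg_cst|exact: cvg_id].
Qed.

(** In the Abel partial sums at D = 0 only j = 0 has a nonzero integral, and the geometric remainder
    is uniform. *)
Lemma Rintegral_Pker r x : 0 <= r < 1 -> \int[mu]_(y in T) Pker r (x - y) = 2 * pi.
Proof.
move=> r01.
have cP : continuous (fun y => Pker r (x - y)).
  by apply: continuous_subl; exact: continuous_Pker.
have c1 : continuous (fun y => (1 + Pker r (x - y)) / 2).
  by move=> y; apply: cvgMl; apply: cvgD; [exact: cvg_cst|exact: cP].
pose Sg N y := \sum_(j < N) r ^+ j * cos (j%:R * (x - y)).
have cS N : continuous (Sg N).
  elim: N => [|N IH] y.
    by rewrite /Sg; under eq_fun do rewrite big_ord0; exact: cvg_cst.
  rewrite /Sg; under eq_fun do rewrite big_ord_recr/=.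
  by apply: cvgD; [exact: IH|apply: cvgMr; exact: continuous_cos_affine].
have iS N : \int[mu]_(y in T) Sg N.+1 y = 2 * pi.
  elim: N => [|N IH].
    rewrite (_ : Sg 1 = cst 1); last first.
      by apply/funext => y; rewrite /Sg big_ord1 mul0r cos0 mulr1 expr0.
    by rewrite Rintegral_cst// [X in fine X]mu_T mul1r.
  transitivity (\int[mu]_(y in T) Sg N.+1 y +
      r ^+ N.+1 * \int[mu]_(y in T) cos (N.+1%:R * (x - y))); last first.
    by rewrite Rintegral_cos_conv// mulr0 addr0 IH.
  have cc := @continuous_cos_affine N.+1%:R x.
  rewrite -RintegralZl//; last exact: continuous_integrable.
  rewrite -RintegralD//; [|exact: continuous_integrable|].
    by apply: eq_Rintegral => y _; rewrite /Sg big_ord_recr.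
  by apply: continuous_integrable => y; apply: cvgMr; exact: cc.
have e0 : \int[mu]_(y in T) ((1 + Pker r (x - y)) / 2) - 2 * pi = 0.
  apply: (@norm_le_remainder_eq0 r _ (2 * pi) r01) => N.
  rewrite -[X in _ - X](iS N) distrC -RintegralB//; [|exact: continuous_integrable..].
  have cD : continuous (fun y => Sg N.+1 y - (1 + Pker r (x - y)) / 2).
    by move=> y; apply: cvgB; [exact: cS|exact: c1].
  apply: le_trans (le_normr_Rintegral _ _) _ => //; first exact: continuous_integrable.
  rewrite -[X in _ <= _ * X](_ : fine (mu T) = _); last by rewrite [X in fine X]mu_T.
  rewrite -Rintegral_cst//; apply: le_Rintegral => //.
  - apply: continuous_integrable => y; apply: cvg_norm; exact: cD.
  - by apply: continuous_integrable => y; exact: cvg_cst.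
  - move=> y _; have := @abel_remainder R r (x - y) 0 N.+1 r01.
    rewrite abel_kernelE// cos0 sin0 mul1r mul0r subr0 /Sg.
    by under eq_bigr do rewrite add0r.
have e1 : \int[mu]_(y in T) ((1 + Pker r (x - y)) / 2) =
    2^-1 * (2 * pi + \int[mu]_(y in T) Pker r (x - y)).
  have i1 : \int[mu]_(y in T) (1 : R) = 2 * pi by rewrite Rintegral_cst// [X in fine X]mu_T mul1r.
  transitivity (2^-1 * (\int[mu]_(y in T) (1 : R) + \int[mu]_(y in T) Pker r (x - y))); last first.
    by rewrite i1.
  rewrite -RintegralD//; [|by apply: continuous_integrable => y; exact: cvg_cst
                          |exact: continuous_integrable].
  rewrite -RintegralZl//.
    by apply: eq_Rintegral => y _; rewrite mulrC.
  by apply: continuous_integrable => y; apply: cvgD; [exact: cvg_cst|exact: cP].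
by move: e0; rewrite e1; lra.
Qed.

Lemma bmeas_Pker r : 0 <= r < 1 -> bmeas (fun z => Pker r (z.1 - z.2)).
Proof. by move=> r01; exact/bmeas_sub/continuous_Pker. Qed.

(** For q near 1/2 the pointwise bound n^2 is too weak, as only n |g n| is summable. The integrand
    is of order min(n^2, 1/chord2), which n times the Poisson kernel at r = 1 - 1/n dominates; the
    integral of that kernel does not depend on r. *)
Lemma An_bound : exists C : R, 0 <= C /\ forall n, An n <= C * n%:R.
Proof.
have [C [C0 hC]] := en_bound.
exists ((4 + 2 * C) * ((2 * pi) * (2 * pi))); split.
  have p0 := ltW (@pi2_gt0 R).
  by apply: mulr_ge0; [lra|rewrite mulr_ge0].
case=> [|n].
  rewrite mulr0 /An (@eq_J _ _ (fun=> 0)) ?J_cst ?mul0r// => z _.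
  by rewrite /en /Dl mul0r cos0 subrr mul0r.
set k : R := n.+1%:R; have k0 : 0 < k by rewrite ltr0n.
have k1 : 1 <= k by rewrite ler1n.
pose r := 1 - k^-1.
have kV : 0 < k^-1 by rewrite invr_gt0.
have kV1 : k^-1 <= 1 by rewrite invf_le1.
have r01 : 0 <= r < 1.
  by rewrite /r; move: (k^-1) kV kV1 => v v0 v1; apply/andP; split; lra.
have JP : J (fun z => Pker r (z.1 - z.2)) = (2 * pi) * (2 * pi).
  rewrite J_iter1; last exact: bmeas_Pker.
  under eq_Rintegral do rewrite /= Rintegral_Pker//.
  by rewrite Rintegral_cst// [X in fine X]mu_T.
have bP := bmeas_Pker r01.
rewrite mulrAC -JP -J_Z//; apply: le_J; [exact: bmeas_en|exact: bmeasZ|].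
move=> z zS; have := hC n.+1 z zS; rewrite /en -/k.
have Q0 := Qker_gt0 (z.1 - z.2) r01; have := chord2_ge0 (z.1 - z.2).
have QS : Qker r (z.1 - z.2) <= k^-1 ^+ 2 + chord2 (z.1 - z.2).
  rewrite QkerE (_ : 1 - r = k^-1); last by rewrite /r opprB addrCA subrr addr0.
  by rewrite lerD2l ler_piMl ?chord2_ge0//; have /andP[_ /ltW] := r01.
have PE : Pker r (z.1 - z.2) >= k^-1 / Qker r (z.1 - z.2).
  rewrite /Pker ler_pM2r ?invr_gt0// /r; move: (k^-1) kV kV1 => v v0 v1; nra.
have num : 1 - cos (Dl n.+1 z) <= 2 by have := cos_geN1 (Dl n.+1 z); lra.
have num0 : 0 <= 1 - cos (Dl n.+1 z) by have := cos_le1 (Dl n.+1 z); lra.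
move: (chord2 _) (Qker _ _) (Pker _ _) Q0 QS PE (1 - cos _) num num0.
move=> S Q P Q0 QS PE A A2 A0 S0 hA.
apply: (@le_trans _ _ ((4 + 2 * C) * k * (k^-1 / Q))); last first.
  by rewrite ler_wpM2l// mulr_ge0// ?addr_ge0 ?mulr_ge0// ltW.
rewrite (_ : (4 + 2 * C) * k * (k^-1 / Q) = (4 + 2 * C) / Q); last first.
  by field; rewrite !gt_eqF.
rewrite ler_pdivlMr//.
have AS0 : 0 <= A / S by rewrite divr_ge0.
(* The bound A / S <= C k^2 controls the first summand, A <= 2 the second. *)
apply: (@le_trans _ _ (A / S * (k^-1 ^+ 2 + S))); first by rewrite ler_wpM2l.
rewrite mulrDr.
have h1 : A / S * S <= 2.
  move: S0; rewrite le_eqVlt => /predU1P[<-|S0]; first by rewrite mulr0.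
  by rewrite divfK ?gt_eqF.
have h2 : A / S * k^-1 ^+ 2 <= C.
  by rewrite exprVn ler_pdivrMr// exprn_gt0.
by apply: le_trans (lerD h2 h1) _; lra.
Qed.

(** [Ec] and [Es] are the real and imaginary parts of 2 pi a_{-j} for u^n, so [Xn] is 4 pi^2 j
    |a_{-j}|^2 and sums to 4 pi^2 D(u^n). *)
Definition Ec n j : R := \int[mu]_(t in T) cos (n%:R * phi t + j%:R * t).
Definition Es n j : R := \int[mu]_(t in T) sin (n%:R * phi t + j%:R * t).
Definition Xn n j : R := j%:R * (Ec n j ^+ 2 + Es n j ^+ 2).

Lemma Xn_ge0 n j : 0 <= Xn n j.
Proof. by rewrite mulr_ge0// addr_ge0 ?sqr_ge0. Qed.

Let arg n j t := n%:R * phi t + j%:R * t.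

Let continuous_arg n j : continuous (arg n j).
Proof.
move=> t; apply: cvgD; first by apply: cvgMr; exact: continuous_phi.
by apply: cvgMr; exact: cvg_id.
Qed.

Let continuous_cos_arg n j : continuous (fun t => cos (arg n j t)).
Proof. by move=> t; apply: continuous_comp; [exact: continuous_arg|exact: continuous_cos]. Qed.

Let continuous_sin_arg n j : continuous (fun t => sin (arg n j t)).
Proof. by move=> t; apply: continuous_comp; [exact: continuous_arg|exact: continuous_sin]. Qed.

Let is_derive_arg n j t : is_derive t 1 (arg n j) (n%:R * w t + j%:R).
Proof.
rewrite /arg; have h := dphi t.
by apply: is_derive_eq; rewrite /GRing.scale/=; ring.
Qed.

Let arg_2pi n j : arg n j (2 * pi) = arg n j 0 + 2 * pi * (n * d)%:R + 2 * pi * j%:R.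
Proof. by rewrite /arg -[2 * pi]add0r phi_per add0r natrM; ring. Qed.

Let continuous_nw n (k : R -> R) : continuous k -> continuous (fun t => n%:R * w t * k t).
Proof. by move=> ck t; apply: cvgM; [apply: cvgMr; exact: cw|exact: ck]. Qed.

(** The boundary terms agree because the phase gains 2 pi (n d + j) over a period. *)
Lemma Ec_ibp n j : j%:R * Ec n j = - \int[mu]_(t in T) (n%:R * w t * cos (arg n j t)).
Proof.
have cA : continuous (fun t => n%:R * w t * cos (arg n j t)) by exact: continuous_nw.
have cB : continuous (fun t => j%:R * cos (arg n j t)).
  by move=> t; apply: cvgMr; exact: continuous_cos_arg.
have cf : continuous (fun t => n%:R * w t * cos (arg n j t) + j%:R * cos (arg n j t)).
  by move=> t; apply: cvgD; [exact: cA|exact: cB].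
have dF t : 0 < t < 2 * pi -> is_derive t 1 (fun t => sin (arg n j t))
    (n%:R * w t * cos (arg n j t) + j%:R * cos (arg n j t)).
  move=> _; have h := is_derive_arg n j t.
  by apply: is_derive_eq (is_derive1_comp (is_derive_sin _) h) _; ring.
have := Rintegral_derive pi2_gt0 (continuous_subspaceT cf)
  (continuous_subspaceT (@continuous_sin_arg n j)) dF.
rewrite arg_2pi !sin_shift subrr RintegralD//; [|exact: continuous_integrable..].
rewrite RintegralZl//; last exact/continuous_integrable/continuous_cos_arg.
by rewrite -/(Ec n j) addrC => /eqP; rewrite addr_eq0 => /eqP.
Qed.

Lemma Es_ibp n j : j%:R * Es n j = - \int[mu]_(t in T) (n%:R * w t * sin (arg n j t)).
Proof.
have cA : continuous (fun t => n%:R * w t * sin (arg n j t)) by exact: continuous_nw.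
have cB : continuous (fun t => j%:R * sin (arg n j t)).
  by move=> t; apply: cvgMr; exact: continuous_sin_arg.
have cf : continuous (fun t => n%:R * w t * sin (arg n j t) + j%:R * sin (arg n j t)).
  by move=> t; apply: cvgD; [exact: cA|exact: cB].
have dF t : 0 < t < 2 * pi -> is_derive t 1 (fun t => - cos (arg n j t))
    (n%:R * w t * sin (arg n j t) + j%:R * sin (arg n j t)).
  move=> _; have h := is_derive_arg n j t.
  by apply: is_derive_eq (is_deriveN (is_derive1_comp (is_derive_cos _) h)) _; ring.
have cN : continuous (fun t => - cos (arg n j t)).
  by move=> t; apply: cvgN; exact: continuous_cos_arg.
have := Rintegral_derive pi2_gt0 (continuous_subspaceT cf) (continuous_subspaceT cN) dF.
rewrite arg_2pi !cos_shift subrr RintegralD//; [|exact: continuous_integrable..].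
rewrite RintegralZl//; last exact/continuous_integrable/continuous_sin_arg.
by rewrite -/(Es n j) addrC => /eqP; rewrite addr_eq0 => /eqP.
Qed.

Let bmeas_nw n : bmeas (fun z => n%:R * w z.1).
Proof. by apply: (@bmeas_fst R (fun t => n%:R * w t)) => t; apply: cvgMr; exact: cw. Qed.

Let measurable_Dlh n (c : R) : measurable_fun setT (fun z => Dl n z + c * (z.1 - z.2)).
Proof.
apply: measurable_funD; first exact: measurable_Dl.
apply: measurable_funM; first exact: measurable_cst.
by apply: measurable_funB; [exact: measurable_fst|exact: measurable_snd].
Qed.

Let bmeas_term n j :
  bmeas (fun z => n%:R * w z.1 * cos (Dl n z + j%:R * (z.1 - z.2))).
Proof. by apply: bmeasM => //; exact: bmeas_cos_comp. Qed.

(** Integrating by parts in one of the two factors of the square trades the weight j for n w, so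
    that summation over j becomes geometric under the double integral. *)
Lemma Xn_J n j :
  Xn n j = - J (fun z => n%:R * w z.1 * cos (Dl n z + j%:R * (z.1 - z.2))).
Proof.
have cA : continuous (fun t => n%:R * w t * cos (arg n j t)) by exact: continuous_nw.
have cB : continuous (fun t => n%:R * w t * sin (arg n j t)) by exact: continuous_nw.
have -> : (fun z : R * R => n%:R * w z.1 * cos (Dl n z + j%:R * (z.1 - z.2))) =
  (fun z => (n%:R * w z.1 * cos (arg n j z.1)) * cos (arg n j z.2) +
            (n%:R * w z.1 * sin (arg n j z.1)) * sin (arg n j z.2)).
  apply/funext => z; rewrite (_ : Dl n z + _ = arg n j z.1 - arg n j z.2).
    by rewrite cosB; ring.
  by rewrite /Dl /arg; ring.
rewrite J_D; last 2 first.
- by apply: bmeasM; [exact: (bmeas_fst cA)|exact: (bmeas_snd (@continuous_cos_arg n j))].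
- by apply: bmeasM; [exact: (bmeas_fst cB)|exact: (bmeas_snd (@continuous_sin_arg n j))].
rewrite (J_prod cA (@continuous_cos_arg n j)) (J_prod cB (@continuous_sin_arg n j)).
rewrite opprD -!mulNr -Ec_ibp -Es_ibp -/(Ec n j) -/(Es n j) /Xn; ring.
Qed.

(** The Abel sum of the [Xn n j] at radius r, with the geometric sum in closed form. *)
Definition Yn n r : R :=
  - J (fun z => n%:R * w z.1 *
       ((cos (Dl n z) - r * cos (Dl n z - (z.1 - z.2))) / Qker r (z.1 - z.2))).

Let kernel_bmeas n r : 0 <= r < 1 ->
  bmeas (fun z => (cos (Dl n z) - r * cos (Dl n z - (z.1 - z.2))) / Qker r (z.1 - z.2)).
Proof.
move=> r01; under eq_fun do rewrite abel_kernelE//.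
apply: bmeasB; apply: bmeasM.
- exact: bmeas_cosD.
- under eq_fun do rewrite mulrC.
  by apply: bmeasZ; apply: bmeasD; [exact: bmeas_cst|exact: bmeas_Pker].
- exact: bmeas_sinD.
- exact/bmeas_sub/continuous_sker.
Qed.

Lemma Xn_abel_cvg n r : 0 <= r < 1 ->
  (fun N => \sum_(j < N) r ^+ j * Xn n j) @ \oo --> Yn n r.
Proof.
move=> r01.
have [M hM] := continuous_bounded (ltW (@pi2_gt0 R)) cw.
have bK := kernel_bmeas n r01.
have e N : `|Yn n r - \sum_(j < N) r ^+ j * Xn n j| <=
    2 * r ^+ N / (1 - r) ^+ 2 * (n%:R * M * ((2 * pi) * (2 * pi))).
  have bT j : bmeas (fun z => r ^+ j * (n%:R * w z.1 * cos (Dl n z + j%:R * (z.1 - z.2)))).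
    exact: bmeasZ.
  have -> : \sum_(j < N) r ^+ j * Xn n j = - J (fun z => \sum_(j < N)
      r ^+ j * (n%:R * w z.1 * cos (Dl n z + j%:R * (z.1 - z.2)))).
    rewrite (J_sum N bT) -sumrN; apply: eq_bigr => j _.
    by rewrite Xn_J J_Z// mulrN.
  have bS := bmeas_sum N bT.
  rewrite opprK addrC -J_B//; last exact: bmeasM.
  rewrite mulrA; apply: norm_J_le; first by apply: bmeasB => //; exact: bmeasM.
  move=> z zS; have := @abel_remainder R r (z.1 - z.2) (Dl n z) N r01.
  have -> : \sum_(j < N) r ^+ j * (n%:R * w z.1 * cos (Dl n z + j%:R * (z.1 - z.2))) =
    n%:R * w z.1 * \sum_(j < N) r ^+ j * cos (Dl n z + j%:R * (z.1 - z.2)).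
    by rewrite mulr_sumr; apply: eq_bigr => j _; rewrite mulrCA.
  rewrite -mulrBr normrM => h.
  rewrite (_ : _ * (n%:R * M) = n%:R * M * (2 * r ^+ N / (1 - r) ^+ 2)); last by rewrite mulrC.
  rewrite ler_pM//.
  rewrite normrM normr_nat ler_wpM2l// hM//.
  by case: zS => /=; rewrite in_itv.
apply/subr_cvg0/cvgr0Pnorm_le => eps eps0; near=> N; rewrite distrC; apply: le_trans (e N) _.
near: N; have /cvgr0_norm_le/(_ eps eps0) := @remainder_cvg0 r (n%:R * M * ((2 * pi) * (2 * pi))) r01.
by apply: filterS => N /(le_trans (ler_norm _)).
Unshelve. all: by end_near. Qed.

(** Read off from [Xn_J] at j = 0, where the weight j makes the left side zero. *)
Let J_nw_cosD n : J (fun z => n%:R * w z.1 * cos (Dl n z)) = 0.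
Proof.
have := Xn_J n 0; rewrite /Xn mul0r => /esym/eqP; rewrite oppr_eq0 => /eqP.
by under eq_fun do rewrite mul0r addr0.
Qed.

Let Rintegral_w : \int[mu]_(t in T) w t = 2 * pi * d%:R.
Proof.
rewrite (Rintegral_derive pi2_gt0 (continuous_subspaceT cw) (continuous_subspaceT continuous_phi)
  (fun t _ => dphi t)).
by rewrite -[X in phi X]add0r phi_per addrC addKr.
Qed.

(** The origin of the degree in Douglas' formula: the kernel integrates to 2 pi in y, and [w] to 2
    pi d over a period. *)
Let J_nw_Pker n r : 0 <= r < 1 ->
  J (fun z => n%:R * w z.1 * Pker r (z.1 - z.2)) = 4 * pi ^+ 2 * (n * d)%:R.
Proof.
move=> r01; rewrite J_iter1; last by apply: bmeasM => //; exact: bmeas_Pker.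
transitivity (\int[mu]_(t in T) (2 * pi * n%:R * w t)).
  apply: eq_Rintegral => x _ /=; rewrite RintegralZl//.
    by rewrite Rintegral_Pker//; ring.
  by apply: continuous_integrable; apply: continuous_subl; exact: continuous_Pker.
rewrite RintegralZl//; last exact: continuous_integrable.
by rewrite Rintegral_w natrM; ring.
Qed.

Let sker_shift r h : sker r (h + 2 * pi) = sker r h.
Proof.
rewrite /sker /Qker; have := cos_shift h 1; have := sin_shift h 1.
by rewrite mulr1 => -> ->.
Qed.

(** Integration by parts in x at fixed y. The primitive of n w sin is taken as 1 - cos, so that the
    more singular kernel [dsker] meets a factor vanishing on the diagonal. *)
Let J_nw_sin_sker n r : 0 <= r < 1 ->
  J (fun z => n%:R * w z.1 * (sin (Dl n z) * sker r (z.1 - z.2))) =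
  J (fun z => (1 - cos (Dl n z)) * - dsker r (z.1 - z.2)).
Proof.
move=> r01.
have b1 : bmeas (fun z => n%:R * w z.1 * (sin (Dl n z) * sker r (z.1 - z.2))).
  by apply: bmeasM => //; apply: bmeasM; [exact: bmeas_sinD|exact/bmeas_sub/continuous_sker].
have b2 : bmeas (fun z => (1 - cos (Dl n z)) * - dsker r (z.1 - z.2)).
  apply: bmeasM; first exact: bmeas_1cosD.
  by apply: bmeasN; exact/bmeas_sub/continuous_dsker.
apply/eqP; rewrite -subr_eq0 -J_B// J_iter2; last exact: bmeasB.
rewrite (@eq_Rintegral _ _ _ mu _ (fun=> 0)) ?Rintegral_cst ?mul0r// => y _ /=.
pose f x := n%:R * w x * (sin (Dl n (x, y)) * sker r (x - y)) -
  (1 - cos (Dl n (x, y))) * - dsker r (x - y).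
pose F x := (1 - cos (Dl n (x, y))) * sker r (x - y).
have dD x : is_derive x 1 (fun x => Dl n (x, y)) (n%:R * w x).
  rewrite /Dl/=; have h := dphi x.
  by apply: is_derive_eq; rewrite /GRing.scale/=; ring.
have ds x : is_derive x 1 (fun x => sker r (x - y)) (dsker r (x - y)).
  have h := is_derive_sker (x - y) r01.
  have h2 : is_derive x 1 (fun x : R => x - y) (1 : R).
    by apply: is_derive_eq; rewrite subr0.
  have := @is_derive1_comp _ (sker r) (fun x : R => x - y) x _ _ h h2.
  by rewrite mulr1.
have dF x : 0 < x < 2 * pi -> is_derive x 1 F (f x).
  move=> _; have h1 := dD x; have h2 := ds x.
  have h3 := @is_derive1_comp _ (@cos R) (fun x => Dl n (x, y)) x _ _ (is_derive_cos _) h1.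
  have h4 : is_derive x 1 (fun x => 1 - cos (Dl n (x, y))) (sin (Dl n (x, y)) * (n%:R * w x)).
    apply: is_derive_eq (is_deriveB (is_derive_cst (1 : R) x (1 : R)) h3) _.
    by ring.
  apply: is_derive_eq (is_deriveM h4 h2) _; rewrite /f /GRing.scale/=; ring.
have cD : continuous (fun x => Dl n (x, y)).
  move=> x; apply: differentiable_continuous; apply/derivable1_diffP; by case: (dD x).
have csub (k : R -> R) : continuous k -> continuous (fun x => k (x - y)).
  move=> ck x; apply: continuous_comp; last exact: ck.
  by apply: cvgB; [exact: cvg_id|exact: cvg_cst].
have ccos : continuous (fun x => 1 - cos (Dl n (x, y))).
  move=> x; apply: cvgB; first exact: cvg_cst.
  by apply: continuous_comp; [exact: cD|exact: continuous_cos].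
have csin : continuous (fun x => sin (Dl n (x, y))).
  by move=> x; apply: continuous_comp; [exact: cD|exact: continuous_sin].
have cF : continuous F.
  by move=> x; apply: cvgM; [exact: ccos|exact/csub/continuous_sker].
have cf : continuous f.
  move=> x; apply: cvgB; apply: cvgM.
  - by apply: cvgMr; exact: cw.
  - by apply: cvgM; [exact: csin|exact/csub/continuous_sker].
  - exact: ccos.
  - by apply: cvgN; exact/csub/continuous_dsker.
rewrite (Rintegral_derive pi2_gt0 (continuous_subspaceT cf) (continuous_subspaceT cF) dF).
rewrite /F (_ : 2 * pi - y = 0 - y + 2 * pi) ?sker_shift; last by ring.
have -> : Dl n (2 * pi, y) = Dl n (0, y) + 2 * pi * (n * d)%:R.
  by rewrite /Dl/= -[X in phi X]add0r phi_per natrM; ring.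
by rewrite cos_shift subrr.
Qed.

(** In the Poisson part, cos is written as 1 - (1 - cos): the 1 gives the degree term, and the rest
    vanishes as r -> 1. *)
Lemma Yn_eq n r : 0 <= r < 1 -> Yn n r =
  J (fun z => (1 - cos (Dl n z)) * - dsker r (z.1 - z.2)) - 2 * pi ^+ 2 * (n * d)%:R +
  J (fun z => (1 - cos (Dl n z)) * (n%:R * w z.1 * Pker r (z.1 - z.2))) / 2.
Proof.
move=> r01; rewrite -J_nw_sin_sker//.
have bP := bmeas_Pker r01.
have bs : bmeas (fun z => sker r (z.1 - z.2)) by exact/bmeas_sub/continuous_sker.
have b1 : bmeas (fun z => n%:R * w z.1 * cos (Dl n z)) by apply: bmeasM => //; exact: bmeas_cosD.
have b2 : bmeas (fun z => n%:R * w z.1 * Pker r (z.1 - z.2)) by exact: bmeasM.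
have b3 : bmeas (fun z => (1 - cos (Dl n z)) * (n%:R * w z.1 * Pker r (z.1 - z.2))).
  by apply: bmeasM => //; exact: bmeas_1cosD.
have b4 : bmeas (fun z => n%:R * w z.1 * (sin (Dl n z) * sker r (z.1 - z.2))).
  by apply: bmeasM => //; apply: bmeasM => //; exact: bmeas_sinD.
rewrite /Yn (@eq_J _ _ (fun z => 2^-1 * (n%:R * w z.1 * cos (Dl n z) +
    (n%:R * w z.1 * Pker r (z.1 - z.2) -
     (1 - cos (Dl n z)) * (n%:R * w z.1 * Pker r (z.1 - z.2)))) -
   n%:R * w z.1 * (sin (Dl n z) * sker r (z.1 - z.2)))); last first.
  by move=> z _; rewrite abel_kernelE//; field.
have b5 := bmeasB b2 b3; have b6 := bmeasD b1 b5; have b7 := bmeasZ (2^-1) b6.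
rewrite (J_B b7 b4) (J_Z _ b6) (J_D b1 b5) (J_B b2 b3) J_nw_cosD J_nw_Pker//.
by field.
Qed.

(** The offset 2 keeps the radius strictly positive, as [Pker_chord2] and [dsker_chord2] require. *)
Let rk (k : nat) : R := 1 - (k.+2%:R)^-1.

Let rk01 k : 0 < rk k < 1.
Proof.
have h : 0 < (k.+2%:R : R)^-1 by rewrite invr_gt0.
have h1 : (k.+2%:R : R)^-1 < 1 by rewrite invf_lt1// ltr1n.
by rewrite /rk; move: (k.+2%:R^-1) h h1 => v h h1; apply/andP; split; lra.
Qed.

Let rk_cvg : rk @ \oo --> (1 : R).
Proof.
rewrite -[X in _ --> X](subr0 (1 : R)); apply: cvgB; first exact: cvg_cst.
by rewrite (cvg_shiftS (fun n => (n.+1%:R : R)^-1)); exact: cvg_harmonic.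
Qed.

Lemma Yn_cvg n : (fun k => Yn n (rk k)) @ \oo --> An n - 2 * pi ^+ 2 * (n * d)%:R.
Proof.
have [C [C0 hC]] := en_bound.
have [M hM] := continuous_bounded (ltW (@pi2_gt0 R)) cw.
have rk01' k : 0 <= rk k < 1 by have /andP[/ltW -> ->] := rk01 k.
have enS z : en n z * chord2 (z.1 - z.2) = 1 - cos (Dl n z) \/ ~ Sq z.
  have [zS|zS] := pselect (Sq z); [left|by right].
  have := chord2_ge0 (z.1 - z.2); rewrite le_eqVlt => /predU1P[S0|S0]; last first.
    by rewrite /en divfK// gt_eqF.
  have [C' [_ hC']] := phi_arc_bound.
  rewrite -S0 mulr0; case: z zS S0 => x y [/= xT yT] S0.
  have := hC' n x y xT yT; rewrite -S0 mulr0 => h.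
  by apply/eqP; rewrite eq_sym eq_le h subr_ge0 cos_le1.
(* Dominated convergence: by [dsker_chord2] the integrand is at most [en n z] in absolute value for
   every radius. *)
have lim1 : (fun k => J (fun z => (1 - cos (Dl n z)) * - dsker (rk k) (z.1 - z.2))) @ \oo -->
    An n.
  apply: (@J_cvg _ _ _ (C * n%:R ^+ 2)).
  - move=> k; apply: bmeasM; first exact: bmeas_1cosD.
    by apply: bmeasN; exact/bmeas_sub/continuous_dsker.
  - exact: bmeas_en.
  - move=> k z zS; have [E|//] := enS z; rewrite -E normrM normrN normrM.
    rewrite (ger0_norm (en_ge0 n z)) (ger0_norm (chord2_ge0 _)) -mulrA mulrC.
    apply: (@le_trans _ _ (1 * en n z)); last by rewrite mul1r hC.
    by rewrite ler_wpM2r ?en_ge0// mulrC; exact: dsker_chord2 (rk01 k).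
  - move=> z zS; have [E|//] := enS z.
    have := chord2_ge0 (z.1 - z.2); rewrite le_eqVlt => /predU1P[S0|S0].
      rewrite -E /en -S0 invr0 !mulr0.
      by under eq_fun do rewrite mul0r; exact: cvg_cst.
    by apply: cvgMr; exact: dsker_cvg.
(* Writing 1 - cos as [en] times [chord2] lets [Pker_chord2] make the integrand uniformly small. *)
have lim2 : (fun k => J (fun z => (1 - cos (Dl n z)) *
    (n%:R * w z.1 * Pker (rk k) (z.1 - z.2))) / 2) @ \oo --> (0 : R).
  pose K := C * n%:R ^+ 2 * (n%:R * M) * ((2 * pi) * (2 * pi)).
  have b k : `|J (fun z => (1 - cos (Dl n z)) * (n%:R * w z.1 * Pker (rk k) (z.1 - z.2))) / 2|
      <= K * ((1 - rk k ^+ 2) / rk k).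
    have r2 : 0 <= (1 - rk k ^+ 2) / rk k.
      have /andP[r0 r1] := rk01 k.
      by rewrite divr_ge0 ?(ltW r0)// subr_ge0 expr_le1// ltW.
    rewrite normrM [`|2^-1|]ger0_norm ?invr_ge0//.
    apply: (@le_trans _ _ `|J (fun z => (1 - cos (Dl n z)) *
       (n%:R * w z.1 * Pker (rk k) (z.1 - z.2)))|).
      by rewrite ler_piMr// invf_le1// ler1n.
    rewrite /K mulrAC; apply: norm_J_le.
      apply: bmeasM; first exact: bmeas_1cosD.
      by apply: bmeasM => //; exact: bmeas_Pker.
    move=> z zS; have [E|//] := enS z.
    rewrite -E normrM (ger0_norm (mulr_ge0 (en_ge0 n z) (chord2_ge0 _))) normrM.
    rewrite [`|Pker _ _|]ger0_norm ?Pker_ge0//.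
    rewrite (_ : en n z * _ * _ = en n z * `|n%:R * w z.1| *
      (chord2 (z.1 - z.2) * Pker (rk k) (z.1 - z.2))); last by ring.
    have w0 : `|n%:R * w z.1| <= n%:R * M.
      rewrite normrM normr_nat ler_wpM2l// hM//.
      by case: zS => /=; rewrite in_itv.
    apply: ler_pM.
    - by apply: mulr_ge0 => //; exact: en_ge0.
    - by apply: mulr_ge0; [exact: chord2_ge0|exact: Pker_ge0].
    - by apply: ler_pM => //; [exact: en_ge0|exact: hC].
    - exact: Pker_chord2.
  apply/cvgr0Pnorm_le => eps eps0; near=> k; apply: le_trans (b k) _.
  near: k.
  have l : (fun k => K * ((1 - rk k ^+ 2) / rk k)) @ \oo --> K * ((1 - 1 * 1) / 1).
    apply: cvgMr; apply: cvgM; last by apply: cvgV; [exact: oner_neq0|].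
    by apply: cvgB; [exact: cvg_cst|apply: cvgM].
  rewrite mulr1 subrr mul0r mulr0 in l.
  have /cvgr0_norm_le/(_ eps eps0) := l.
  by apply: filterS => k /(le_trans (ler_norm _)).
have -> : (fun k => Yn n (rk k)) = (fun k =>
  J (fun z => (1 - cos (Dl n z)) * - dsker (rk k) (z.1 - z.2)) - 2 * pi ^+ 2 * (n * d)%:R +
  J (fun z => (1 - cos (Dl n z)) * (n%:R * w z.1 * Pker (rk k) (z.1 - z.2))) / 2).
  by apply/funext => k; rewrite Yn_eq.
rewrite -[X in _ --> X]addr0; apply: cvgD => //.
by apply: cvgB => //; exact: cvg_cst.
Unshelve. all: by end_near. Qed.

(** For nonnegative terms Abel summability is convergence: each partial sum is a limit of truncated
    Abel sums, which [Yn] bounds, and each Abel sum is at most the limit of the partial sums. *)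
Theorem douglas_formula n :
  (fun N => \sum_(j < N) Xn n j) @ \oo --> An n - 2 * pi ^+ 2 * (n * d)%:R.
Proof.
set B := An n - _.
have rk01' k : 0 <= rk k < 1 by have /andP[/ltW -> ->] := rk01 k.
pose U N := \sum_(j < N) Xn n j.
have ndU : {homo U : a b / (a <= b)%N >-> a <= b}.
  apply: homo_leq => [//|x y z|N]; first exact: le_trans.
  by rewrite /U big_ord_recr/= lerDl Xn_ge0.
have YE k N : \sum_(j < N) rk k ^+ j * Xn n j <= Yn n (rk k).
  have /andP[r0 _] := rk01' k.
  have L := @Xn_abel_cvg n _ (rk01' k).
  rewrite -(cvg_lim (@Rhausdorff R) L).
  apply: (@nondecreasing_cvgn_le _ (fun N => \sum_(j < N) rk k ^+ j * Xn n j)).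
    apply/nondecreasing_seqP => m; rewrite big_ord_recr/= lerDl.
    by rewrite mulr_ge0 ?exprn_ge0 ?Xn_ge0.
  by apply/cvg_ex; exists (Yn n (rk k)).
have rkX j : (fun k => rk k ^+ j) @ \oo --> (1 : R).
  elim: j => [|j IH]; first by under eq_fun do rewrite expr0; exact: cvg_cst.
  under eq_fun do rewrite exprS.
  by have := cvgM rk_cvg IH; rewrite mulr1; apply.
have abelU N : (fun k => \sum_(j < N) rk k ^+ j * Xn n j) @ \oo --> U N.
  elim: N => [|N IH].
    by rewrite /U big_ord0; under eq_fun do rewrite big_ord0; exact: cvg_cst.
  rewrite /U big_ord_recr/=; under eq_fun do rewrite big_ord_recr/=.
  apply: cvgD => //; rewrite -[X in _ --> X]mul1r; apply: cvgMl; exact: rkX.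
have UB N : U N <= B.
  apply: (ler_cvg_to (abelU N) (@Yn_cvg n)).
  by apply: nearW => k; exact: YE.
have cU : cvgn U.
  by apply: nondecreasing_is_cvgn => //; exists B => _ [N _ <-].
suff <- : limn U = B by [].
apply/eqP; rewrite eq_le; apply/andP; split.
  by apply: limr_le => //; exact: nearW.
apply: (@cvgr_to_le _ \oo _ _ (fun k => Yn n (rk k))); first exact: Yn_cvg.
apply: nearW => k.
apply: (@cvgr_to_le _ \oo _ _ (fun N => \sum_(j < N) rk k ^+ j * Xn n j)).
  exact: Xn_abel_cvg.
apply: nearW => N; apply: (@le_trans _ _ (U N)); last exact: nondecreasing_cvgn_le.
apply: ler_sum => j _; have /andP[r0 r1] := rk01' k.
by rewrite ler_piMl ?Xn_ge0// exprn_ile1// ltW.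
Qed.

End douglas.

(** * Differentiability of the lift *)

Section lift.
Context {R : realType}.

Lemma derivable_continuous (f : R -> R) : (forall t, derivable f t 1) -> continuous f.
Proof.
by move=> df t; apply: differentiable_continuous; apply/derivable1_diffP; exact: df.
Qed.

(** The lift is only known to be continuous. Near t it stays within pi/2 of [phi t], so phi s - phi
    t is the [asin] of sin (phi s - phi t) = b s a t - a s b t, which is differentiable in s. *)
Lemma lift_is_derive (phi a b : R -> R) : continuous phi ->
  (forall t, derivable a t 1) -> (forall t, derivable b t 1) ->
  (forall t, a t = cos (phi t)) -> (forall t, b t = sin (phi t)) ->
  forall t : R, is_derive t 1 phi (derive1 b t * a t - derive1 a t * b t).
Proof.
move=> cphi da db aE bE t.
have ha : is_derive t 1 a (derive1 a t) by split => //; rewrite derive1E.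
have hb : is_derive t 1 b (derive1 b t) by split => //; rewrite derive1E.
pose f s := phi t + asin (b s * a t - a s * b t).
have near_f : \forall s \near t, f s = phi s.
  have p0 : 0 < pi / 2 :> R by rewrite divr_gt0// pi_gt0.
  have := cphi t => /cvgrPdist_lt/(_ _ p0); apply: filterS => s hs.
  rewrite /f aE bE aE bE mulrC [cos (phi s) * _]mulrC [cos (phi t) * _]mulrC.
  rewrite [sin (phi t) * _]mulrC -sinB sinK; first by rewrite addrC subrK.
  rewrite distrC in hs; have := ltW hs; rewrite ler_norml => /andP[h1 h2].
  by rewrite in_itv/= h1.
apply: near_eq_is_derive near_f _.
have g0 : b t * a t - a t * b t = 0 by rewrite mulrC subrr.
have hg : is_derive t 1 (fun s => b s * a t - a s * b t) (derive1 b t * a t - derive1 a t * b t).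
  by apply: is_derive_eq; rewrite /GRing.scale/=; ring.
have hs : is_derive (b t * a t - a t * b t) 1 asin (1 : R).
  rewrite g0; have := @is_derive1_asin R 0.
  by rewrite expr0n subr0 sqrtr1 invr1; apply; rewrite ltrN10 ltr01.
have hc := @is_derive1_comp _ asin (fun s => b s * a t - a s * b t) t _ _ hs hg.
apply: is_derive_eq (is_deriveD (is_derive_cst (phi t) t (1 : R)) hc) _.
by rewrite add0r mul1r.
Qed.

End lift.

(** * Products and distances on the unit circle *)

Section circle_algebra.
Context {R : realType}.
Implicit Types (a b t : R) (n : nat).

Lemma expiD a b : expi a * expi b = expi (a + b) :> R[i].
Proof. by rewrite /expi sinD cosD; congr (_ +i* _); ring. Qed.

Lemma expiX a n : expi a ^+ n = expi (n%:R * a) :> R[i].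
Proof.
elim: n => [|n IH]; first by rewrite expr0 mul0r /expi cos0 sin0.
by rewrite exprS IH expiD -natr1; congr expi; ring.
Qed.

Lemma cabs_sqr (x y : R) : cabs (x +i* y) ^+ 2 = x ^+ 2 + y ^+ 2.
Proof. by rewrite /cabs /= sqr_sqrtr// addr_ge0 ?sqr_ge0. Qed.

Lemma cabs_expiB a b : cabs (expi a - expi b) = Num.sqrt (chord2 (a - b)).
Proof.
rewrite /cabs /expi /= /chord2 cosB; congr Num.sqrt.
have ha := cos2Dsin2 a; have hb := cos2Dsin2 b.
transitivity ((cos a ^+ 2 + sin a ^+ 2) + (cos b ^+ 2 + sin b ^+ 2) -
  2 * (cos a * cos b + sin a * sin b)); first by ring.
by rewrite ha hb; ring.
Qed.

Lemma cabs_expiB_powR a b (p : R) : cabs (expi a - expi b) `^ p = chord2 (a - b) `^ (p / 2).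
Proof. by rewrite cabs_expiB -powR12_sqrt ?chord2_ge0// -powRrM mulrC. Qed.

End circle_algebra.

(** * Real series as extended-real sums *)

Section series_EFin.
Context {R : realType}.

Lemma eseries_EFin (x : nat -> R) (l : R) : series x @ \oo --> l ->
  (\sum_(n <oo) (x n)%:E = l%:E)%E.
Proof.
move=> xl; apply: cvg_lim; first exact: ereal_hausdorff.
under eq_fun do rewrite sumEFin.
by apply: cvg_EFin; [exact: nearW|exact: xl].
Qed.

Lemma eseries1_EFin (x : nat -> R) (l : R) : x 0%N = 0 -> series x @ \oo --> l ->
  (\sum_(1 <= n <oo) (x n)%:E = l%:E)%E.
Proof.
move=> x0 xl; apply: cvg_lim; first exact: ereal_hausdorff.
have -> : (fun N => \sum_(1 <= n < N) (x n)%:E)%E = EFin \o series x.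
  apply/funext => -[|N] /=; first by rewrite /series/= !big_geq.
  by rewrite sumEFin /series/= [in RHS]big_ltn// x0 add0r.
by apply: cvg_EFin; [exact: nearW|exact: xl].
Qed.

End series_EFin.

(** * The energy as a series of double integrals *)

Section energy_series.
Context {R : realType}.
Implicit Types (x y t h r : R) (n m j N : nat) (z : R * R).
Notation mu := (@lebesgue_measure R).
Notation T := (`[0, 2 * pi]%classic : set R).
Variables (phi w : R -> R) (d : nat).
Hypothesis dphi : forall t, is_derive t 1 phi (w t).
Hypothesis cw : continuous w.
Hypothesis phi_per : forall t, phi (t + 2 * pi) = phi t + 2 * pi * d%:R.
Variable q : R.
Hypothesis q_gt : 1 / 2 < q.
Local Notation g := (gseq q).
Local Notation e := (en phi).
Local Notation A := (An phi).

Let f z : R := chord2 (phi z.1 - phi z.2) `^ q / chord2 (z.1 - z.2).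

Lemma chord2_powR_expansion_all h :
  series (fun n => g n * (1 - cos (n%:R * h))) @ \oo --> chord2 h `^ q.
Proof.
have p2 := @pi2_gt0 R.
pose k := Num.floor (h / (2 * pi)).
pose h0 := h - 2 * pi * k%:~R.
have h0T : 0 <= h0 <= 2 * pi.
  have := floor_itv (h / (2 * pi)); rewrite -/k => /andP[k1 k2].
  move: k1 k2; rewrite ler_pdivlMr// ltr_pdivrMr// intrD1 => k1 k2.
  by rewrite /h0; apply/andP; split; lra.
have cosE n : cos (n%:R * h) = cos (n%:R * h0).
  have [k0|k0] := leP 0 k.
    rewrite -(gez0_abs k0) -pmulrn in h0 h0T *.
    rewrite -[RHS](cos_shift _ (n * `|k|)%N); congr cos.
    by rewrite /h0 natrM; ring.
  have kE : k%:~R = - (`|k|%N)%:R :> R.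
    by rewrite -[RHS]/(- (`|k|%N)%:~R) -mulrNz ltz0_abs// opprK.
  rewrite -[LHS](cos_shift _ (n * `|k|)%N); congr cos.
  by rewrite /h0 kE natrM; ring.
have -> : chord2 h = chord2 h0 by have := cosE 1%N; rewrite !mul1r /chord2 => ->.
have -> : series (fun n => g n * (1 - cos (n%:R * h))) =
    (fun N => \sum_(n < N) g n * (1 - cos (n%:R * h0))).
  apply/funext => N; rewrite /series/= big_mkord.
  by apply: eq_bigr => i _; rewrite cosE.
exact: chord2_powR_expansion.
Qed.

(** The signs of [g n] may vary; positive and negative parts make termwise integration an instance
    of Tonelli. *)
Let gp n := Num.max (g n) 0.
Let gm n := Num.max (- g n) 0.

Let gp0 n : 0 <= gp n. Proof. by rewrite le_max lexx orbT. Qed.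

Let gm0 n : 0 <= gm n. Proof. by rewrite le_max lexx orbT. Qed.

Let gpm n : gp n - gm n = g n.
Proof. by rewrite /gp /gm /Num.max; case: ifPn; case: ifPn; lra. Qed.

Let gp_le n : gp n <= `|g n|.
Proof. by rewrite ge_max ler_norm normr_ge0. Qed.

Let gm_le n : gm n <= `|g n|.
Proof. by rewrite ge_max -normrN ler_norm normr_ge0. Qed.

Let dominated_series (c : nat -> R) (x : nat -> R) (C : R) :
  (forall n, 0 <= c n) -> (forall n, c n <= `|g n|) -> (forall n, 0 <= x n) ->
  (forall n, x n <= C * n%:R) -> cvgn (series (fun n => c n * x n)).
Proof.
move=> c0 cg x0 xC.
have h : cvgn (series (fun n => C * (n%:R * `|g n|))).
  by apply: is_cvg_seriesZ; exact: cvg_gseq_weighted.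
apply: (series_le_cvg _ _ _ h) => n; first exact: mulr_ge0.
- by rewrite mulrA mulr_ge0// (le_trans (x0 n)).
- by rewrite mulrA [leRHS]mulrC; exact: ler_pM.
Qed.

Let e_le n z : e n z <= 2 / chord2 (z.1 - z.2) * n%:R.
Proof.
case: n => [|n].
  by rewrite mulr0 /en /Dl mul0r cos0 subrr mul0r.
apply: (@le_trans _ _ (2 / chord2 (z.1 - z.2))).
  rewrite ler_wpM2r ?invr_ge0 ?chord2_ge0//.
  by have := cos_geN1 (Dl phi n.+1 z); lra.
by rewrite ler_peMr ?ler1n// divr_ge0 ?chord2_ge0.
Qed.

Let cvg_gp_e z : cvgn (series (fun n => gp n * e n z)).
Proof.
apply: (@dominated_series _ _ (2 / chord2 (z.1 - z.2))) => // n.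
exact: en_ge0.
Qed.

Let cvg_gm_e z : cvgn (series (fun n => gm n * e n z)).
Proof.
apply: (@dominated_series _ _ (2 / chord2 (z.1 - z.2))) => // n.
exact: en_ge0.
Qed.

(** A sum rather than a difference, so that it integrates in the extended reals before the integral
    of [f] is known to be finite. *)
Let f_split z : f z + limn (series (fun n => gm n * e n z)) = limn (series (fun n => gp n * e n z)).
Proof.
suff -> : f z = limn (series (fun n => gp n * e n z)) -
    limn (series (fun n => gm n * e n z)) by rewrite subrK.
have h1 : series (fun n => g n * e n z) @ \oo --> f z.
  have := @chord2_powR_expansion_all (phi z.1 - phi z.2) => h.
  have : series (fun n => g n * (1 - cos (n%:R * (phi z.1 - phi z.2)))) N
      / chord2 (z.1 - z.2) @[N --> \oo] --> f z by apply: cvgMl; exact: h.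
  apply: cvg_trans; apply: near_eq_cvg; apply: nearW => N /=.
  rewrite /series/= mulr_suml; apply: eq_bigr => n _.
  by rewrite /en /Dl mulrA.
have h2 : series (fun n => gp n * e n z) N - series (fun n => gm n * e n z) N @[N --> \oo] -->
    limn (series (fun n => gp n * e n z)) - limn (series (fun n => gm n * e n z)).
  by apply: cvgB; [exact: cvg_gp_e|exact: cvg_gm_e].
suff h3 : series (fun n => g n * e n z) @ \oo -->
    limn (series (fun n => gp n * e n z)) - limn (series (fun n => gm n * e n z)).
  by apply: (cvg_unique _ h1 h3).
apply: cvg_trans h2; apply: near_eq_cvg; apply: nearW => N /=.
rewrite /series/= -sumrB; apply: eq_bigr => n _.
by rewrite -mulrBl gpm.
Qed.

Let bmeas_e n : bmeas (e n). Proof. exact: bmeas_en. Qed.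

Let cvg_A (c : nat -> R) : (forall n, 0 <= c n) -> (forall n, c n <= `|g n|) ->
  cvgn (series (fun n => c n * A n)).
Proof.
move=> c0 cg; have [C [_ hC]] := An_bound dphi cw phi_per.
by apply: (@dominated_series _ _ C) => // n; exact: An_ge0.
Qed.

Let measurable_f : measurable_fun setT f.
Proof.
apply: measurable_funM; last exact: measurable_inv_chord2.
apply: (@measurableT_comp _ _ _ _ _ _ (fun s : R => s `^ q)).
  exact: measurable_powR.
apply: (@measurableT_comp _ _ _ _ _ _ (@chord2 R)).
  by apply: continuous_measurable_fun; exact: continuous_chord2.
have cphi : continuous phi.
  by apply: derivable_continuous => t; case: (dphi t).
apply: measurable_funB; apply: measurableT_comp.
- exact: continuous_measurable_fun.
- exact: measurable_fst.
- exact: continuous_measurable_fun.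
- exact: measurable_snd.
Qed.

Let f_ge0 z : 0 <= f z.
Proof. by rewrite divr_ge0 ?powR_ge0 ?chord2_ge0. Qed.

Let integral_weighted (c : nat -> R) : (forall n, 0 <= c n) -> (forall n, c n <= `|g n|) ->
  (\int[mu2]_(z in Sq) (\sum_(n <oo) (c n * e n z)%:E) =
    (limn (series (fun n => c n * A n)))%:E)%E.
Proof.
move=> c0 cg; rewrite integral_nneseries.
- rewrite -(eseries_EFin (cvg_A c0 cg)); apply: eq_eseriesr => n _.
  by rewrite -J_Z// -EFin_J//; exact: bmeasZ.
- exact: measurable_Sq.
- move=> n; apply/measurable_EFinP; apply: measurable_funTS.
  by case: (bmeasZ (c n) (bmeas_e n)).
- by move=> n z _; rewrite lee_fin mulr_ge0// en_ge0.
Qed.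

Lemma integral_energy_density :
  (\int[mu]_(x in T) \int[mu]_(y in T)
     (chord2 (phi x - phi y) `^ q / chord2 (x - y))%:E =
   (limn (series (fun n => g n * A n)))%:E)%E.
Proof.
have mE : measurable_fun setT (fun z => (f z)%:E) by apply/measurable_EFinP.
have mc (c : nat -> R) : (forall n, 0 <= c n) ->
    measurable_fun Sq (fun z => \sum_(n <oo) (c n * e n z)%:E)%E.
  move=> c0; apply: ge0_emeasurable_sum => [n z _ _|n _].
    by rewrite lee_fin mulr_ge0// en_ge0.
  apply/measurable_EFinP; apply: measurable_funTS.
  by case: (bmeasZ (c n) (bmeas_e n)).
transitivity (\int[mu2]_(z in Sq) (f z)%:E)%E.
  by rewrite integral_Sq.
have := integral_weighted gp0 gp_le; have := integral_weighted gm0 gm_le.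
have cp := cvg_A gp0 gp_le; have cm := cvg_A gm0 gm_le.
have -> : limn (series (fun n => g n * A n)) =
    limn (series (fun n => gp n * A n)) - limn (series (fun n => gm n * A n)).
  apply: cvg_lim => //; apply: cvg_trans (cvgB cp cm).
  apply: near_eq_cvg; apply: nearW => N /=.
  rewrite /series/= !fctE -sumrB; apply: eq_bigr => n _.
  by rewrite -mulrBl gpm.
move=> hm hp.
have sum_split z : ((f z)%:E + \sum_(n <oo) (gm n * e n z)%:E =
    \sum_(n <oo) (gp n * e n z)%:E)%E.
  rewrite (eseries_EFin (@cvg_gm_e z)) (eseries_EFin (@cvg_gp_e z)).
  by rewrite -EFinD f_split.
have : (\int[mu2]_(z in Sq) (f z)%:E + \int[mu2]_(z in Sq) (\sum_(n <oo) (gm n * e n z)%:E) =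
    \int[mu2]_(z in Sq) (\sum_(n <oo) (gp n * e n z)%:E))%E.
  rewrite -ge0_integralD.
  - by apply: eq_integral => z _; exact: sum_split.
  - exact: measurable_Sq.
  - by move=> z _; rewrite lee_fin.
  - exact: measurable_funTS.
  - by move=> z _; apply: nneseries_ge0 => n _ _; rewrite lee_fin mulr_ge0// en_ge0.
  - exact: mc.
(* The other two integrals are finite, which excludes infinite values here. *)
rewrite hm hp; case: (\int[mu2]_(z in Sq) _)%E => //= r.
by rewrite -EFinD => -[<-]; rewrite addrK.
Qed.

Lemma cvg_gseq_An : cvgn (series (fun n => g n * A n)).
Proof.
have cp := cvg_A gp0 gp_le; have cm := cvg_A gm0 gm_le.
apply/cvg_ex; exists (limn (series (fun n => gp n * A n)) - limn (series (fun n => gm n * A n))).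
apply: cvg_trans (cvgB cp cm).
apply: near_eq_cvg; apply: nearW => N /=.
rewrite /series/= !fctE -sumrB; apply: eq_bigr => n _.
by rewrite -mulrBl gpm.
Qed.

Lemma cvg_gseq_normed (x : nat -> R) (C : R) :
  (forall n, 0 <= x n) -> (forall n, x n <= C * n%:R) ->
  cvgn (series (fun n => `|g n| * x n)).
Proof. by move=> x0 xC; apply: (@dominated_series _ _ C). Qed.

End energy_series.

(** * Defect and energy in terms of the lift *)

Section defect_formula.
Context {R : realType}.
Notation mu := (@lebesgue_measure R).
Notation T := (`[0, 2 * pi]%classic : set R).

Lemma fourier_coef_phase (v : R[i] -> R[i]) (phi : R -> R) (n j : nat) :
  (forall t, v (expi t) = expi (n%:R * phi t)) ->
  fourier_coef v (- j%:Z) =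
    ((2 * pi)^-1 * Ec phi n j) +i* ((2 * pi)^-1 * Es phi n j).
Proof.
move=> vE; rewrite /fourier_coef.
have gE t : v (expi t) * expi (- ((- j%:Z)%:~R * t)) = expi (n%:R * phi t + j%:R * t).
  by rewrite vE expiD mulrNz mulNr opprK.
congr (_ +i* _); congr (_ * _).
  by apply: eq_Rintegral => t _; rewrite gE.
by apply: eq_Rintegral => t _; rewrite gE.
Qed.

Lemma defectE (v : R[i] -> R[i]) (phi w : R -> R) (d n : nat) :
  (forall t : R, is_derive t 1 phi (w t)) -> continuous w ->
  (forall t, phi (t + 2 * pi) = phi t + 2 * pi * d%:R) ->
  (forall t, v (expi t) = expi (n%:R * phi t)) ->
  defect v = ((4 * pi ^+ 2)^-1 * (An phi n - 2 * pi ^+ 2 * (n * d)%:R))%:E.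
Proof.
move=> dphi cw per vE; rewrite /defect.
transitivity (\sum_(1 <= j <oo) ((4 * pi ^+ 2)^-1 * Xn phi n j)%:E)%E.
  apply: eq_eseriesr => j _; congr EFin.
  rewrite (fourier_coef_phase j vE) cabs_sqr /Xn !exprMn -mulrDr mulrCA; congr (_ * _).
  by rewrite exprVn; congr (_^-1); ring.
apply: eseries1_EFin; first by rewrite /Xn mul0r mulr0.
have : (4 * pi ^+ 2)^-1 * (\sum_(j < N) Xn phi n j) @[N --> \oo] -->
    (4 * pi ^+ 2)^-1 * (An phi n - 2 * pi ^+ 2 * (n * d)%:R).
  by apply: cvgMr; exact: douglas_formula.
apply: cvg_trans; apply: near_eq_cvg; apply: nearW => N /=.
by rewrite /series/= big_mkord mulr_sumr.
Qed.

(** Douglas' formula read backwards: for j > 0 the phase (n d + j) t has nonzero frequency, so every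
    [Xn] vanishes and [An] equals its degree term. *)
Lemma An_linear (d n : nat) : An (fun t : R => d%:R * t) n = 2 * pi ^+ 2 * (n * d)%:R.
Proof.
set psi := fun t : R => d%:R * t.
have dl (t : R) : is_derive t 1 psi (d%:R : R).
  by apply: is_derive_eq; rewrite /GRing.scale/= mulr1.
have per (t : R) : psi (t + 2 * pi) = psi t + 2 * pi * d%:R by rewrite /psi; ring.
have cpsi : continuous (fun _ : R => d%:R : R) by move=> t; exact: cvg_cst.
have := @douglas_formula R _ (fun _ : R => d%:R) d dl cpsi per n.
have X0 j : Xn psi n j = 0.
  case: j => [|j]; first by rewrite /Xn mul0r.
  have argE (t : R) : n%:R * psi t + j.+1%:R * t = (n * d + j.+1)%:R * t.
    by rewrite /psi natrD natrM; ring.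
  have m0 : (0 < n * d + j.+1)%N by rewrite addnS.
  have m0' : (n * d + j.+1)%:R != 0 :> R by rewrite pnatr_eq0 -lt0n.
  have E0 : Ec psi n j.+1 = 0.
    rewrite -(@Rintegral_cos_nat R (n * d + j.+1) m0); apply: eq_Rintegral => t _.
    by rewrite argE.
  have E1 : Es psi n j.+1 = 0.
    set m := (n * d + j.+1)%N in argE m0 m0'.
    have cs : continuous (fun t : R => sin (m%:R * t)).
      by move=> t; apply: continuous_comp; [exact: mulrl_continuous|exact: continuous_sin].
    have cF : continuous (fun t : R => - cos (m%:R * t) / m%:R).
      move=> t; apply: cvgMl; apply: cvgN.
      by apply: continuous_comp; [exact: mulrl_continuous|exact: continuous_cos].
    have dF t : 0 < t < 2 * pi ->
        is_derive t 1 (fun t : R => - cos (m%:R * t) / m%:R) (sin (m%:R * t)).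
      by move=> _; apply: is_derive_eq; rewrite /GRing.scale/=; field.
    transitivity (\int[mu]_(t in T) sin (m%:R * t)).
      by apply: eq_Rintegral => t _; rewrite argE.
    rewrite (Rintegral_derive pi2_gt0 (continuous_subspaceT cs) (continuous_subspaceT cF) dF).
    by rewrite cos_nat2pi mulr0 cos0 subrr.
  by rewrite /Xn E0 E1 expr0n addr0 mulr0.
move=> h.
have h0 : (fun N => \sum_(j < N) Xn psi n j) @ \oo --> (0 : R).
  rewrite (_ : (fun N => _) = cst 0); first exact: cvg_cst.
  by apply/funext => N; rewrite big1.
have : 0 = An psi n - 2 * pi ^+ 2 * (n * d)%:R.
  by apply: (cvg_unique _ h0 h).
by move/esym/eqP; rewrite subr_eq0 => /eqP.
Qed.

Lemma energyE (s : R) (v : R[i] -> R[i]) (phi : R -> R) :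
  (forall t, v (expi t) = expi (phi t)) ->
  energy s v = (\int[mu]_(x in T) \int[mu]_(y in T)
     (chord2 (phi x - phi y) `^ (s^-1 / 2) / chord2 (x - y))%:E)%E.
Proof.
move=> vE; rewrite /energy; apply: eq_integral => x _; apply: eq_integral => y _.
rewrite !vE cabs_expiB_powR; congr (_ / _)%:E.
by rewrite cabs_expiB sqr_sqrtr ?chord2_ge0.
Qed.

End defect_formula.

Theorem proposition4p1 (R : realType) (u : R[i] -> R[i]) (d : nat)
  (u_circle : circle_map u) (u_smooth : smooth_on_circle u)
  (d_ge1 : (1 <= d)%N) (u_deg : has_degree u d%:Z)
  (s : R) (s_gt0 : 0 < s) (s_lt1 : s < 1) :
  let p := s^-1 in
  let term := fun n : nat =>
    ((gamma_coef p n)%:E * defect (fun z => u z ^+ n)%R)%E in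
  (energy s u - energy s (fun z => z ^+ d)%R
     = (4 * pi ^+ 2)%R%:E * \sum_(1 <= n <oo) term n)%E
  /\ (\sum_(1 <= n <oo) `|term n| < +oo)%E.
Proof.
move=> p term.
have [phi [cphi uE per']] := u_deg.
have per t : phi (t + 2 * pi) = phi t + 2 * pi * d%:R by rewrite per' -pmulrn.
have [sa sb] := u_smooth.
pose a t := complex.Re (u (expi t)); pose b t := complex.Im (u (expi t)).
have aE t : a t = cos (phi t) by rewrite /a uE.
have bE t : b t = sin (phi t) by rewrite /b uE.
(* The imaginary part of the conjugate of u times u', that is, the derivative of the argument. *)
pose w t := derive1 b t * a t - derive1 a t * b t.
have da (t : R) : derivable a t 1 by exact: (sa 0%N t).
have db (t : R) : derivable b t 1 by exact: (sb 0%N t).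
have dphi (t : R) : is_derive t 1 phi (w t) by exact: lift_is_derive.
have cw : continuous w.
  have ca := derivable_continuous da; have cb := derivable_continuous db.
  have ca' : continuous (derive1 a) by apply: derivable_continuous => t; exact: (sa 1%N t).
  have cb' : continuous (derive1 b) by apply: derivable_continuous => t; exact: (sb 1%N t).
  by move=> t; apply: cvgB; apply: cvgM; [exact: cb'|exact: ca|exact: ca'|exact: cb].
have p1 : 1 < p by rewrite /p -[1]invr1 ltf_pV2 ?posrE.
pose q := p / 2.
have q_gt : 1 / 2 < q by rewrite /q ltr_pM2r.
have q0 : 0 < q by apply: lt_trans q_gt; rewrite divr_gt0.
have pq : p = 2 * q by rewrite /q mulrC divfK.
have p20 : 0 < 4 * pi ^+ 2 :> R by rewrite mulr_gt0// exprn_gt0// pi_gt0.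
pose psi (t : R) : R := d%:R * t.
have dpsi (t : R) : is_derive t 1 psi (d%:R : R).
  by apply: is_derive_eq; rewrite /GRing.scale/= mulr1.
have cpsi : continuous (fun _ : R => d%:R : R) by move=> t; exact: cvg_cst.
have psi_per t : psi (t + 2 * pi) = psi t + 2 * pi * d%:R by rewrite /psi; ring.
have Eu : energy s u = (limn (series (fun n => gseq q n * An phi n)))%:E.
  by rewrite (energyE s uE) (integral_energy_density dphi cw per q_gt).
have Ez : energy s (fun z => z ^+ d) = (limn (series (fun n => gseq q n * An psi n)))%:E.
  rewrite (@energyE _ s _ psi); last by move=> t; rewrite expiX.
  by rewrite (integral_energy_density dpsi cpsi psi_per q_gt).
pose D n := (4 * pi ^+ 2)^-1 * (An phi n - 2 * pi ^+ 2 * (n * d)%:R).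
have termE n : term n = (gseq q n * D n)%:E.
  rewrite /term pq gamma_coefE// (@defectE _ _ phi w d n)//.
  by move=> t; rewrite uE expiX.
have cu := cvg_gseq_An dphi cw per q_gt.
have cz := cvg_gseq_An dpsi cpsi psi_per q_gt.
pose L := (4 * pi ^+ 2)^-1 * (limn (series (fun n => gseq q n * An phi n)) -
  limn (series (fun n => gseq q n * An psi n))).
(* By [An_linear] the degree term in [D n] is [An psi n], so the two energy series subtract term by
   term. *)
have cL : series (fun n => gseq q n * D n) @ \oo --> L.
  have : (4 * pi ^+ 2)^-1 * (series (fun n => gseq q n * An phi n) N -
      series (fun n => gseq q n * An psi n) N) @[N --> \oo] --> L.
    by apply: cvgMr; exact: (cvgB cu cz).
  apply: cvg_trans.
  apply: near_eq_cvg; apply: nearW => N /=.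
  rewrite /series/= -sumrB mulr_sumr; apply: eq_bigr => n _.
  by rewrite /D /psi An_linear; ring.
(* The sums of the statement start at 1 and [series] at 0; the term of index 0 vanishes. *)
have D0 : D 0%N = 0.
  have [C [_ hC]] := An_bound dphi cw per.
  have := hC 0%N; rewrite mulr0 => h.
  have A0 : An phi 0 = 0 by apply/eqP; rewrite eq_le h An_ge0.
  by rewrite /D A0 mul0n mulr0 subrr mulr0.
split.
  rewrite Eu Ez -EFinB (@eq_eseriesr _ _ (fun n => (gseq q n * D n)%:E)); last first.
    by move=> n _; exact: termE.
  rewrite (eseries1_EFin _ cL) ?D0 ?mulr0// -EFinM /L mulrA divff ?mul1r//.
  by rewrite gt_eqF.
rewrite (@eq_eseriesr _ _ (fun n => (`|gseq q n| * `|D n|)%:E)); last first.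
  by move=> n _; rewrite termE abse_EFin normrM.
have [C [C0 hC]] := An_bound dphi cw per.
(* [D n] grows at most linearly, by [An_bound] and the degree term, and n |g n| is summable. *)
have cn : cvgn (series (fun n => `|gseq q n| * `|D n|)).
  apply: (@cvg_gseq_normed _ _ q_gt _ ((4 * pi ^+ 2)^-1 * (C + 2 * pi ^+ 2 * d%:R))) => // n.
  rewrite /D normrM ger0_norm ?invr_ge0 ?(ltW p20)// -[leRHS]mulrA ler_wpM2l ?invr_ge0 ?(ltW p20)//.
  rewrite (le_trans (ler_normB _ _))// [leRHS]mulrDl lerD//.
    by rewrite ger0_norm ?An_ge0.
  have p0 : 0 <= 2 * pi ^+ 2 :> R by rewrite mulr_ge0// sqr_ge0.
  have <- : 2 * pi ^+ 2 * (n * d)%:R = 2 * pi ^+ 2 * d%:R * n%:R :> R by rewrite natrM; ring.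
  by rewrite ger0_norm// mulr_ge0.
rewrite (eseries1_EFin _ cn) ?ltry//.
by rewrite D0 normr0 mulr0.
Qed.
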